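(* Let $0<T_{\min}\le T_{\max}$. Suppose there exists a piecewise-$C^1$ function $P_s:[0,T_{\max}]\to\mathbb H^n_{\succeq0}$ satisfying: (i) for $\tau\in(0,T_{\max})$, $\mathcal C_Z(\tau,P_s(\tau))\succeq0$ and $(\mathcal C_Z)_1-(\mathcal C_Z)_2(\mathcal C_Z)_3^\dagger(\mathcal C_Z)_2^*=0$; (ii) for all $\tau\in[T_{\min},T_{\max}]$ (and each jump index $k$), $\mathcal D_Z(k,P_s(0^+),P_s(\tau^-))\succeq0$ and $(\mathcal D_Z)_1-(\mathcal D_Z)_2(\mathcal D_Z)_3^\dagger(\mathcal D_Z)_2^*=0$. Then for any dwell-time sequence with $\Delta_k=t_{k+1}-t_k\in[T_{\min},T_{\max}]$, the policy $K(\tau)\in\mathcal K_c(\tau,P_s(\tau))$ on flow and $K_k\in\mathcal K_d(k,P_s(0^+),P_s(\Delta_{k-1}^-))$ at each jump $t_k$ is causal and achieves $J_T(X^\star,X_1^0)\le\langle P_s(0),X_1^0\rangle$ for all $T>0$, where $X^\star$ is the resulting trajectory. In particular, $J_\infty^\star(X_1^0)\le\langle P_s(0),X_1^0\rangle$. The gain $K_k$ depends only on the just-observed dwell-time $\Delta_{k-1}$, which is available at $t_k$, so the policy is fully causal.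
   Context: Notation. Fix integers $n,m\ge1$. $\mathbb H^p$, $\mathbb H^p_{\succeq0}$: $p\times p$ complex Hermitian, resp. positive semidefinite, matrices; $\langle A,B\rangle=\operatorname{trace}(AB^* )$; $A^\dagger$ is the Moore–Penrose pseudoinverse. $E=[I_n\ \ 0]\in\mathbb C^{n\times(n+m)}$. Write $X=\begin{bmatrix}X_1&X_2^*\\ X_2&X_3\end{bmatrix}$ with $X_1=EXE^*$. System. Initial time $t_0$, jump times $t_1<t_2<\cdots$, $t_k\to\infty$; timer $\tau(t)=t-t_k$ for $t\in[t_k,t_{k+1})$, $k\ge0$. The flow data depend on time only through the timer. Dynamics $$E\dot X(t)E^*=\mathcal F(\tau(t),X(t))\ (t\ne t_k),\quad EX(t_k^+)E^*=\mathcal J(k,X(t_k^-)),\quad EX(t_0)E^*=X_1^0\in\mathbb H^n_{\succeq0}.$$ $\mathcal F(\tau,\cdot),\mathcal J(k,\cdot):\mathbb H^{n+m}\to\mathbb H^n$ are linear and bounded, $\mathcal F$ is continuous in $\tau$, both leave the positive semidefinite cone invariant (the state block stays positive semidefinite); adjoints: $\langle P,\mathcal F(\tau,X)\rangle=\langle\mathcal F^*(\tau,P),X\rangle$, $\langle P,\mathcal J(k,X)\rangle=\langle\mathcal J^*(k,P),X\rangle$. A trajectory is an $\mathbb H^{n+m}_{\succeq0}$-valued function satisfying these equations (regular enough that the limits and integrals involved make sense); $X_2,X_3$ are free. A policy with flow gain $K$ and jump gains $K_k$ means $X_2=KX_1$, $X_3=KX_1K^*$ on flow, and the same with $K_k$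 at $t_k^-$. Causal means that the gains at each time depend only on information available then (the timer and past dwell-times), not on future jump times. Cost. $Z(\tau)\succeq0$, $Z_k\succeq0$ in $\mathbb H^{n+m}$; $J_T(X,X_1^0)=\int_{t_0}^{t_0+T}\langle Z(\tau(t)),X(t)\rangle dt+\sum_{t_k\in(t_0,t_0+T)}\langle Z_k,X(t_k^-)\rangle$ (no terminal cost); $J_\infty$ is the same with $T=\infty$ and $J_\infty^\star(X_1^0)$ is its infimum over trajectories. Operators. $\mathcal C_Z(\tau,P(\tau))=E^*\tfrac{dP}{d\tau}(\tau)E+\mathcal F^*(\tau,P(\tau))+Z(\tau)$, $\mathcal D_Z(k,P^+,P^-)=\mathcal J^*(k,P^+)-E^*P^-E+Z_k$. Matrices $\mathcal L\in\mathbb H^{n+m}$ are partitioned as $\begin{bmatrix}\mathcal L_1&\mathcal L_2\\ \mathcal L_2^*&\mathcal L_3\end{bmatrix}$ with $\mathcal L_1\in\mathbb H^n$, $\mathcal L_3\in\mathbb H^m$. Gain sets: $\mathcal K_c(\tau,P(\tau))=\{K\in\mathbb C^{m\times n}:(\mathcal C_Z)_3K+(\mathcal C_Z)_2^*=0\}$, $\mathcal K_d(k,P^+,P^-)=\{K\in\mathbb C^{m\times n}:(\mathcal D_Z)_3K+(\mathcal D_Z)_2^*=0\}$. $P_s(0)$ denotes $P_s(0^+)$.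
   Formalization: The bounds, including the one on J_∞^⋆, are stated assuming the closed-loop trajectory X^⋆ exists (unbounded gains can make it blow up, and then the bound on J_∞^⋆ can fail); piecewise-C^1 is read as continuous on (0,T_max). *)

(* Defs.v *)
From HB Require Import structures.
From mathcomp Require Import all_boot all_order all_algebra.
From mathcomp Require Import complex.
From mathcomp Require Import all_classical all_reals all_analysis.

Set Implicit Arguments.
Unset Strict Implicit.
Unset Printing Implicit Defensive.

Import Order.TTheory GRing.Theory Num.Theory.
Import numFieldNormedType.Exports.

Local Open Scope classical_set_scope.
Local Open Scope ring_scope.
Local Open Scope sesquilinear_scope.

(** * Matrices over the complex numbers [R[i]] *)

Definition psdmx (R : realType) (p : nat) (A : 'M[R[i]]_p) : Prop :=
  A \is hermsymmx /\ forall v : 'cV[R[i]]_p, 0 <= (v ^t* *m A *m v) 0 0.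

(* The trace form trace(A B^* ); it is real on Hermitian matrices, and we keep
   its real part. *)
Definition inner (R : realType) (p : nat) (A B : 'M[R[i]]_p) : R :=
  complex.Re (\tr (A *m B ^t*)).

Definition penrose (R : realType) (p q : nat)
    (A : 'M[R[i]]_(p, q)) (B : 'M[R[i]]_(q, p)) : Prop :=
  [/\ A *m B *m A = A, B *m A *m B = B,
      (A *m B) ^t* = A *m B & (B *m A) ^t* = B *m A].

(* See [penrose_pseudoinv] and [penrose_inj] for existence and uniqueness. *)
Definition pseudoinv (R : realType) (p q : nat) (A : 'M[R[i]]_(p, q)) :
    'M[R[i]]_(q, p) := xget 0 [set B | penrose A B].

Section pseudoinverse.
Variable R : realType.
Local Notation C := (R[i]).

Lemma ctmxM (p q r : nat) (A : 'M[C]_(p, q)) (B : 'M[C]_(q, r)) :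
  (A *m B) ^t* = B ^t* *m A ^t*.
Proof. by rewrite trmx_mul map_mxM. Qed.

Lemma penrose_inj (p q : nat) (A : 'M[C]_(p, q)) (B B' : 'M[C]_(q, p)) :
  penrose A B -> penrose A B' -> B = B'.
Proof.
move=> [ABA BAB AB BA] [AB'A B'AB' AB' B'A].
have e1 : A *m B = A *m B'.
  rewrite -{1}AB'A -mulmxA -{1}AB -{1}AB' -ctmxM.
  by rewrite mulmxA ABA AB'.
have e2 : B *m A = B' *m A.
  rewrite -{1}AB'A !mulmxA -mulmxA -{1}BA -{1}B'A -ctmxM.
  by rewrite -mulmxA (mulmxA A B A) ABA B'A.
by rewrite -BAB e2 -mulmxA e1 mulmxA B'AB'.
Qed.

Lemma gram_unit (p q : nat) (A : 'M[C]_(p, q)) :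
  row_free A -> A *m A ^t* \in unitmx.
Proof.
move=> fA; rewrite -row_free_unit -kermx_eq0; apply/eqP/row_matrixP => i.
rewrite row0; set u := row i _.
have uG : u *m (A *m A ^t*) = 0.
  by apply/sub_kermxP; exact: row_sub.
have : dotmx (u *m A) (u *m A) = 0 :> C.
  by rewrite dotmxE ctmxM mulmxA -(mulmxA u) uG mul0mx mxE.
move/eqP; rewrite dnorm_eq0 => /eqP uA.
by apply: (row_free_inj fA); rewrite /= uA mul0mx.
Qed.

Lemma penrose_factor (p q r : nat) (L : 'M[C]_(p, r)) (U : 'M[C]_(r, q)) :
  U *m U ^t* \in unitmx -> L ^t* *m L \in unitmx ->
  penrose (L *m U)
    (U ^t* *m invmx (U *m U ^t*) *m (invmx (L ^t* *m L) *m L ^t*)).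
Proof.
move=> uU uL; set B := _ *m (_ *m _).
have herm_inv (M : 'M[C]_r) : M ^t* = M -> (invmx M) ^t* = invmx M.
  by move=> hM; rewrite trmx_inv map_invmx hM.
have AB : L *m U *m B = L *m invmx (L ^t* *m L) *m L ^t*.
  rewrite /B !mulmxA -(mulmxA L U) -(mulmxA L) mulmxV// mulmx1.
  by rewrite -!mulmxA.
have BA : B *m (L *m U) = U ^t* *m invmx (U *m U ^t*) *m U.
  rewrite /B -!mulmxA (mulmxA (L ^t*)) (mulmxA (invmx (L ^t* *m L))).
  by rewrite mulVmx// mul1mx.
split.
- rewrite AB -!mulmxA (mulmxA (L ^t*)) (mulmxA (invmx (L ^t* *m L))).
  by rewrite mulVmx// mul1mx.
- rewrite BA {1}/B !mulmxA -(mulmxA (U ^t* *m _) U) -(mulmxA (U ^t*)).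
  by rewrite mulVmx// mulmx1 /B !mulmxA.
- by rewrite AB !ctmxM trmxCK herm_inv ?mulmxA// ctmxM trmxCK.
- by rewrite BA !ctmxM trmxCK herm_inv ?mulmxA// ctmxM trmxCK.
Qed.

Lemma penrose_pseudoinv (p q : nat) (A : 'M[C]_(p, q)) :
  penrose A (pseudoinv A).
Proof.
suff [B AB] : exists B, penrose A B.
  by rewrite /pseudoinv; case: xgetP => [? -> |/(_ B)].
rewrite -(mulmx_base A); eexists; apply: penrose_factor.
  by apply: gram_unit; rewrite row_base_free.
have := @gram_unit _ _ ((col_base A) ^t*); rewrite trmxCK; apply.
rewrite /row_free mxrank_map mxrank_tr.
by have := col_base_full A; rewrite /row_full.
Qed.

End pseudoinverse.

(** * Calculus for complex-matrix-valued functions of a real variable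

Everything is done on the real coordinates, i.e. the real and imaginary parts
of the entries. *)

Definition coord_all (R : realType) (p q : nat) (Q : (R -> R) -> Prop)
    (f : R -> 'M[R[i]]_(p, q)) : Prop :=
  forall i j, Q (fun s => complex.Re (f s i j)) /\
              Q (fun s => complex.Im (f s i j)).

Definition coordwise (R : realType) (p q : nat) (op : (R -> R) -> R)
    (f : R -> 'M[R[i]]_(p, q)) : 'M[R[i]]_(p, q) :=
  \matrix_(i, j) Complex (op (fun s => complex.Re (f s i j)))
                         (op (fun s => complex.Im (f s i j))).

Section calculus.
Context (R : realType) (p q : nat).
Implicit Type f : R -> 'M[R[i]]_(p, q).

Definition mx_continuous (A : set R) f : Prop :=
  coord_all (fun g => {within A, continuous g}) f.

Definition mx_derivable f (s : R) : Prop :=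
  coord_all (fun g => derivable g s 1) f.

Definition mx_deriv f (s : R) : 'M[R[i]]_(p, q) :=
  coordwise (fun g => derive1 g s) f.

Definition mx_integrable (A : set R) f : Prop :=
  coord_all (fun g => lebesgue_measure.-integrable A (EFin \o g)) f.

Definition mx_integral (A : set R) f : 'M[R[i]]_(p, q) :=
  coordwise (fun g => \int[lebesgue_measure]_(s in A) g s) f.

Definition mx_cvg (F : set_system R) f : Prop :=
  coord_all (fun g => cvg (g @ F)) f.

Definition mx_lim (F : set_system R) f : 'M[R[i]]_(p, q) :=
  coordwise (fun g => lim (g @ F)) f.

(* On the open interval ]a, b[ the function is C^1, and it and its derivative
   have one-sided limits at the end points. *)
Definition C1_piece (a b : R) (g : R -> R) : Prop :=
  [/\ {in `]a, b[, forall s, derivable g s 1},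
      {in `]a, b[, continuous (derive1 g)},
      cvg (g s @[s --> a^'+]) /\ cvg (g s @[s --> b^'-]) &
      cvg (derive1 g s @[s --> a^'+]) /\ cvg (derive1 g s @[s --> b^'-])].

(* Continuous on ]0, T[ and C^1 up to the end points of each of finitely many
   pieces.  The values at 0 and T themselves are not constrained: only the
   one-sided limits there are used. *)
Definition piecewise_C1 (T : R) f : Prop :=
  mx_continuous `]0, T[ f /\
  exists (N : nat) (s : nat -> R),
    [/\ s 0%N = 0, s N = T &
        forall i, (i < N)%N ->
          s i < s i.+1 /\ coord_all (C1_piece (s i) (s i.+1)) f].

End calculus.

(** * Hybrid systems *)

(* Jump data are used for indices k >= 1 only, flow data for timer values >= 0
   only. *)
Record hsystem (R : realType) (n m : nat) := HSystem {
  Fmap : R -> 'M[R[i]]_(n + m) -> 'M[R[i]]_n ;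
  Fadj : R -> 'M[R[i]]_n -> 'M[R[i]]_(n + m) ;
  Jmap : nat -> 'M[R[i]]_(n + m) -> 'M[R[i]]_n ;
  Jadj : nat -> 'M[R[i]]_n -> 'M[R[i]]_(n + m) ;
  Zflow : R -> 'M[R[i]]_(n + m) ;
  Zjump : nat -> 'M[R[i]]_(n + m)
}.

Section hybrid.
Context (R : realType) (n m : nat).
Local Notation C := (R[i]).
Implicit Types (S : hsystem R n m) (t : nat -> R).

Definition Emx : 'M[C]_(n, n + m) := row_mx 1%:M 0.

Definition state_block (X : 'M[C]_(n + m)) : 'M[C]_n := Emx *m X *m Emx ^t*.

Lemma state_blockE (X : 'M[C]_(n + m)) : state_block X = ulsubmx X.
Proof.
rewrite /state_block /Emx -{1}[X]submxK tr_row_mx map_col_mx trmx1 map_mx1.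
rewrite trmx0 map_mx0 mul_row_block mul_row_col.
by rewrite !mul1mx !mul0mx !addr0 mulmx1 mulmx0 addr0.
Qed.

(* The matrix X with X_1 = X1, X_2 = K X_1 and X_3 = K X_1 K^* *)
Definition feedback (K : 'M[C]_(m, n)) (X1 : 'M[C]_n) : 'M[C]_(n + m) :=
  block_mx X1 ((K *m X1) ^t*) (K *m X1) (K *m X1 *m K ^t*).

(* Real-linear maps from Hermitian to Hermitian matrices; such a map is bounded
   since the spaces are finite-dimensional. *)
Definition herm_linear (p q : nat) (f : 'M[C]_p -> 'M[C]_q) : Prop :=
  (forall X, X \is hermsymmx -> f X \is hermsymmx) /\
  (forall (a : R) X Y, X \is hermsymmx -> Y \is hermsymmx ->
     f (real_complex R a *: X + Y) = real_complex R a *: f X + f Y).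

Definition adjoint_pair (p q : nat)
    (f : 'M[C]_p -> 'M[C]_q) (fadj : 'M[C]_q -> 'M[C]_p) : Prop :=
  (forall P, P \is hermsymmx -> fadj P \is hermsymmx) /\
  (forall P X, P \is hermsymmx -> X \is hermsymmx ->
     inner P (f X) = inner (fadj P) X).

(* Every positive semidefinite X has X_2 = K X_1 and X_3 = K X_1 K^* + W for
   some K and some W >= 0.  Invariance of the cone along the flow: for all
   continuous choices of K and W, a state block that starts positive
   semidefinite stays so. *)
Definition flow_invariant (F : R -> 'M[C]_(n + m) -> 'M[C]_n) : Prop :=
  forall (a b : R) (K : R -> 'M[C]_(m, n)) (W : R -> 'M[C]_m)
         (X1 : R -> 'M[C]_n),
    0 <= a -> a <= b ->
    mx_continuous `[a, b] K -> mx_continuous `[a, b] W ->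
    (forall s : R, s \in `[a, b] -> psdmx (W s)) ->
    mx_continuous `[a, b] X1 ->
    (forall s : R, s \in `[a, b] -> X1 s \is hermsymmx) ->
    (forall s : R, s \in `]a, b[ -> mx_derivable X1 s /\
       mx_deriv X1 s = F s (feedback (K s) (X1 s) + block_mx 0 0 0 (W s))) ->
    psdmx (X1 a) ->
    forall s : R, s \in `[a, b] -> psdmx (X1 s).

Record standing_assumptions S : Prop := {
  Fmap_linear : forall tau, 0 <= tau -> herm_linear (Fmap S tau) ;
  Jmap_linear : forall k, (0 < k)%N -> herm_linear (Jmap S k) ;
  Fmap_continuous : forall X, X \is hermsymmx ->
    mx_continuous `[0, +oo[ (fun tau => Fmap S tau X) ;
  Fmap_invariant : flow_invariant (Fmap S) ;
  Jmap_invariant : forall k X, (0 < k)%N -> psdmx X -> psdmx (Jmap S k X) ;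
  Fmap_adjoint : forall tau, 0 <= tau ->
    adjoint_pair (Fmap S tau) (Fadj S tau) ;
  Jmap_adjoint : forall k, (0 < k)%N -> adjoint_pair (Jmap S k) (Jadj S k) ;
  Zflow_psd : forall tau, 0 <= tau -> psdmx (Zflow S tau) ;
  Zjump_psd : forall k, (0 < k)%N -> psdmx (Zjump S k)
}.

(** ** Jump times, trajectories and cost *)

(* [t 0] is the initial time and [t k], for k >= 1, are the jump times. *)
Definition dwell t (k : nat) : R := t k.+1 - t k.

(* Time elapsed since the last instant t k <= s. *)
Definition timer t (s : R) : R := s - sup [set t k | k in [set k | t k <= s]].

Lemma timerE t (k : nat) (s : R) : {homo t : i j / (i < j)%N >-> i < j} ->
  t k <= s < t k.+1 -> timer t s = s - t k.
Proof.
move=> tmono /andP[tks stk]; congr (_ - _).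
have t_le : {homo t : i j / (i <= j)%N >-> i <= j}.
  by move=> i j; rewrite leq_eqVlt => /predU1P[->//|/tmono/ltW].
have ub : ubound [set t k | k in [set k | t k <= s]] (t k).
  move=> _ [j /= tjs <-]; apply: (t_le); rewrite leqNgt; apply/negP => kj.
  by have := lt_le_trans stk (le_trans (t_le _ _ kj) tjs); rewrite ltxx.
apply/eqP; rewrite eq_le; apply/andP; split.
  by apply: ge_sup => //; exists (t k); exists k.
by apply: ub_le_sup; [exists (t k)|exists k].
Qed.

(* [X] is the trajectory with, at t_k, its right limit X(t_k^+); [Xm k] is
   X(t_k^-).  The state block of X(t_k^-) is the left limit of the state block,
   while its other blocks are free: the input acting at a jump is not tied to
   the left limit of the input on the flow.  The flow equation is read in
   integrated (Caratheodory) form, so that inputs which are discontinuous in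
   time are allowed. *)
Record is_trajectory S t (X10 : 'M[C]_n) (X : R -> 'M[C]_(n + m))
    (Xm : nat -> 'M[C]_(n + m)) : Prop := {
  traj_psd : forall s, t 0%N <= s -> psdmx (X s) ;
  traj_jump_psd : forall k, (0 < k)%N -> psdmx (Xm k) ;
  traj_init : state_block (X (t 0%N)) = X10 ;
  traj_integrable : forall k s, t k <= s < t k.+1 ->
    mx_integrable `[t k, s] (fun u => Fmap S (timer t u) (X u)) ;
  traj_flow : forall k s, t k <= s < t k.+1 ->
    state_block (X s) = state_block (X (t k)) +
      mx_integral `[t k, s] (fun u => Fmap S (timer t u) (X u)) ;
  traj_left_cvg : forall k, (0 < k)%N ->
    mx_cvg ((t k)^'-) (fun s => state_block (X s)) ;
  traj_left_lim : forall k, (0 < k)%N ->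
    state_block (Xm k) = mx_lim ((t k)^'-) (fun s => state_block (X s)) ;
  traj_jump : forall k, (0 < k)%N ->
    state_block (X (t k)) = Jmap S k (Xm k) ;
  traj_cost_measurable :
    measurable_fun `[t 0%N, +oo[ (fun s => inner (Zflow S (timer t s)) (X s))
}.

(* J_T for finite T and J_infty for T = +oo *)
Definition cost S t (X : R -> 'M[C]_(n + m)) (Xm : nat -> 'M[C]_(n + m))
    (T : \bar R) : \bar R :=
  (\int[lebesgue_measure]_(s in [set s | (t 0%N <= s)%R /\
        s%:E <= (t 0%N)%:E + T]) (inner (Zflow S (timer t s)) (X s))%:E +
   \sum_(1 <= k <oo | (t k)%:E < (t 0%N)%:E + T)
     (inner (Zjump S k) (Xm k))%:E)%E.

Definition optimal_cost S t (X10 : 'M[C]_n) : \bar R :=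
  ereal_inf [set c | exists X Xm,
    is_trajectory S t X10 X Xm /\ c = cost S t X Xm +oo%E].

(** ** Policies *)

(* Gains may a priori depend on the whole sequence of jump times, future ones
   included. *)
Record policy := Policy {
  flow_gain : (nat -> R) -> R -> 'M[C]_(m, n) ;
  jump_gain : (nat -> R) -> nat -> 'M[C]_(m, n)
}.

Definition follows (pol : policy) t (X : R -> 'M[C]_(n + m))
    (Xm : nat -> 'M[C]_(n + m)) : Prop :=
  (forall s, t 0%N <= s ->
     X s = feedback (flow_gain pol t s) (state_block (X s))) /\
  (forall k, (0 < k)%N ->
     Xm k = feedback (jump_gain pol t k) (state_block (Xm k))).

Definition causal (pol : policy) : Prop :=
  forall t t' : nat -> R,
    {homo t : i j / (i < j)%N >-> i < j} ->
    {homo t' : i j / (i < j)%N >-> i < j} ->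
  forall k : nat, (forall j, (j < k)%N -> dwell t j = dwell t' j) ->
    (forall s s', t k <= s < t k.+1 -> t' k <= s' < t' k.+1 ->
       timer t s = timer t' s' -> flow_gain pol t s = flow_gain pol t' s') /\
    ((0 < k)%N -> jump_gain pol t k = jump_gain pol t' k).

(* Flow gain K(tau) and jump gain K_k = Kd k Delta_{k-1} *)
Definition timer_policy (K : R -> 'M[C]_(m, n)) (Kd : nat -> R -> 'M[C]_(m, n))
    : policy :=
  {| flow_gain := fun t s => K (timer t s) ;
     jump_gain := fun t k => Kd k (dwell t k.-1) |}.

(** ** The operators and the gain sets *)

Definition CZ S (P : R -> 'M[C]_n) (tau : R) : 'M[C]_(n + m) :=
  Emx ^t* *m mx_deriv P tau *m Emx + Fadj S tau (P tau) + Zflow S tau.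

Definition DZ S (k : nat) (Pp Pm : 'M[C]_n) : 'M[C]_(n + m) :=
  Jadj S k Pp - Emx ^t* *m Pm *m Emx + Zjump S k.

Definition schur (L : 'M[C]_(n + m)) : 'M[C]_n :=
  ulsubmx L - ursubmx L *m pseudoinv (drsubmx L) *m (ursubmx L) ^t*.

Definition gain_set (L : 'M[C]_(n + m)) : set 'M[C]_(m, n) :=
  [set K | drsubmx L *m K + (ursubmx L) ^t* = 0].

Definition Kc S (P : R -> 'M[C]_n) (tau : R) : set 'M[C]_(m, n) :=
  gain_set (CZ S P tau).

Definition Kd S (k : nat) (Pp Pm : 'M[C]_n) : set 'M[C]_(m, n) :=
  gain_set (DZ S k Pp Pm).

(* Gains for the policy built from P.  K_c involves the derivative of P, hence
   the restriction to points where it exists; the finitely many break points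
   of P do not matter. *)
Definition gain_selection S (Tmin Tmax : R) (P : R -> 'M[C]_n)
    (K : R -> 'M[C]_(m, n)) (Kj : nat -> R -> 'M[C]_(m, n)) : Prop :=
  (forall tau : R, tau \in `]0, Tmax[ -> mx_derivable P tau ->
     Kc S P tau (K tau)) /\
  (forall (k : nat) (delta : R), (0 < k)%N -> delta \in `[Tmin, Tmax] ->
     Kd S k (mx_lim 0^'+ P) (mx_lim delta^'- P) (Kj k delta)).

End hybrid.

(* Main.v *)
Require Import Defs.
From HB Require Import structures.
From mathcomp Require Import all_boot all_order all_algebra.
From mathcomp Require Import complex.
From mathcomp Require Import ring lra.
From mathcomp Require Import all_classical all_reals all_analysis.
From mathcomp Require Import measurable_realfun.

Set Implicit Arguments.
Unset Strict Implicit.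
Unset Printing Implicit Defensive.

Import Order.TTheory GRing.Theory Num.Theory.
Import numFieldNormedType.Exports.

Local Open Scope classical_set_scope.
Local Open Scope ring_scope.

(** Along a trajectory, call V the pairing of P_s, evaluated at the timer, with
the state block X_1.  On a flow interval the derivative of V is <C_Z, X> minus
the running cost, by the definition of C_Z and the adjoint of the flow map; at
a jump, V changes by <D_Z, X> minus the jump cost.  The policy makes both
pairings vanish: if L >= 0 has zero generalized Schur complement and K solves
L_3 K + L_2^* = 0, then L [I; K] = 0, and the feedback matrix is
[I; K] X_1 [I; K]^* ([inner_feedback0]).  So the cost accumulated so far is
exactly the decrease of V ([flow_balance], [jump_balance]), and V >= 0 because
the trace form of two positive semidefinite matrices is nonnegative
([inner_psd_ge0]).  Hence the cost up to every jump time is at most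
<P_s(0+), X_1^0>, and letting the jump time go to infinity bounds the
infinite-horizon cost ([total_cost_le]), which dominates the cost of every
finite horizon.

Gains exist because L >= 0 forces the range of L_2^* into that of L_3
([psd_block_range]); they are causal because they only read the timer and the
last dwell time.

The analytic difficulty is the derivative of V.  The state solves the flow
equation only in integrated form, so its derivative is merely an integrable
function, while P_s is only piecewise continuously differentiable.  Both are
absolutely continuous, a notion handled here as a pair of a function and an
integrable derivative ([primitive]); the product rule for such pairs
([primitive_mul]) comes from Fubini on a triangle.  The finitely many break
points of P_s are negligible.  As P_s enters at 0 and at the jumps only through
one-sided limits, it is first replaced by the continuous function [mx_extend]
that takes these limits as values. *)

(** * Positive semidefinite block matrices *)

Section linear_algebra.
Local Open Scope sesquilinear_scope.
Variable R : realType.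
Local Notation C := (R[i]).

Lemma ctmxD (p q : nat) (A B : 'M[C]_(p, q)) : (A + B) ^t* = A ^t* + B ^t*.
Proof. by rewrite raddfD /= map_mxD. Qed.

Lemma ctmxN (p q : nat) (A : 'M[C]_(p, q)) : (- A) ^t* = - A ^t*.
Proof. by rewrite raddfN /= map_mxN. Qed.

Lemma ctmxZ (p q : nat) (a : C) (A : 'M[C]_(p, q)) :
  (a *: A) ^t* = Num.conj a *: A ^t*.
Proof. by rewrite linearZ /= map_mxZ. Qed.

Lemma herm_ctmx (p : nat) (A : 'M[C]_p) : A \is hermsymmx -> A ^t* = A.
Proof.
by move=> hA; have := is_hermitianmxP _ _ _ hA; rewrite expr0 scale1r => <-.
Qed.

Lemma sqnorm_cV_ge0 (p : nat) (u : 'cV[C]_p) : 0 <= (u ^t* *m u) 0 0.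
Proof.
rewrite mxE sumr_ge0// => i _.
by rewrite !mxE mulrC mul_conjC_ge0.
Qed.

Lemma sqnorm_cV_eq0 (p : nat) (u : 'cV[C]_p) : (u ^t* *m u) 0 0 = 0 -> u = 0.
Proof.
rewrite mxE => u0; apply/matrixP => i j; rewrite ord1 mxE.
have t0 (k : 'I_p) : true -> 0 <= (u ^t*) 0 k * u k 0.
  by rewrite !mxE mulrC mul_conjC_ge0.
have : (u ^t*) 0 i * u i 0 = 0 by exact: (psumr_eq0P t0 u0).
by rewrite !mxE mulrC => /eqP; rewrite mul_conjC_eq0 => /eqP.
Qed.

(** If u = A v is nonzero, the quadratic form at v - t u is -2 t |u|^2 + O(t^2),
which is negative for a small positive t. *)
Lemma psd_isotropic_ker (p : nat) (A : 'M[C]_p) (v : 'cV[C]_p) :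
  psdmx A -> (v ^t* *m A *m v) 0 0 = 0 -> A *m v = 0.
Proof.
case=> hA A0 v0; set u := A *m v; apply: sqnorm_cV_eq0.
set d := (u ^t* *m u) 0 0; have d0 : 0 <= d by exact: sqnorm_cV_ge0.
set c := (u ^t* *m A *m u) 0 0; have c0 : 0 <= c by exact: A0.
apply/eqP; rewrite eq_le d0 andbT.
have c1 : 0 < c + 1 by rewrite ltr_wpDl.
(* This s makes 2 d - s c, the decrease divided by s, positive whenever d is. *)
set s := d / (c + 1); have s0 : 0 <= s by rewrite divr_ge0// ltW.
have vA : v ^t* *m A = u ^t* by rewrite /u ctmxM herm_ctmx.
have E : (v - s *: u) ^t* *m A *m (v - s *: u) =
    u ^t* *m v - (s *+ 2) *: (u ^t* *m u) + (s * s) *: (u ^t* *m A *m u).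
  rewrite ctmxD ctmxN ctmxZ (conj_Creal (ger0_real s0)).
  rewrite mulmxBl -scalemxAl vA mulmxBr !mulmxBl -!scalemxAl -!scalemxAr.
  rewrite -(mulmxA _ A v) -/u opprB scalerA mulr2n scalerDl opprD !addrA.
  by rewrite addrAC.
have dE : d = s * (c + 1) by rewrite /s divfK// gt_eqF.
have := A0 (v - s *: u).
have -> : ((v - s *: u) ^t* *m A *m (v - s *: u)) 0 0 =
    - (s ^+ 2 * (c + 2%:R)).
  have uv0 : (u ^t* *m v) 0 0 = 0 by rewrite -vA.
  transitivity (0 - (s *+ 2) * d + (s * s) * c).
    by rewrite E 2!mxE uv0 2!mxE [X in _ + X]mxE.
  by rewrite dE; ring.
rewrite oppr_ge0 pmulr_lle0; last by rewrite ltr_wpDl// ltr0n.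
rewrite dE => s2; rewrite (_ : s = 0) ?mul0r//.
by apply/eqP; rewrite -sqrf_eq0 eq_le s2 exprn_ge0.
Qed.

(** Since L >= 0, ker L_3 is contained in ker L_2, so the pseudoinverse of L_3
cancels on the right of L_2. *)
Lemma psd_block_range (n m : nat) (L : 'M[C]_(n + m)) : psdmx L ->
  ursubmx L *m pseudoinv (drsubmx L) *m drsubmx L = ursubmx L.
Proof.
move=> Lpsd; have [LPL _ _ _] := penrose_pseudoinv (drsubmx L).
set D := drsubmx L; set U := ursubmx L; set G := pseudoinv D.
suff : U *m (1%:M - G *m D) = 0.
  by move/eqP; rewrite mulmxBr mulmx1 mulmxA subr_eq0 => /eqP.
apply/matrixP => i j.
suff : col j (U *m (1%:M - G *m D)) = 0 by move/matrixP/(_ i 0); rewrite !mxE.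
rewrite colE -mulmxA; set w := _ *m delta_mx _ _.
have Dw : D *m w = 0.
  by rewrite /w mulmxA mulmxBr mulmx1 mulmxA LPL subrr mul0mx.
have Lw : L *m col_mx 0 w = col_mx (U *m w) 0.
  by rewrite -[L]submxK mul_block_col !mulmx0 !add0r -/D Dw.
have : L *m col_mx 0 w = 0.
  apply: psd_isotropic_ker => //; rewrite -mulmxA Lw.
  rewrite tr_col_mx map_row_mx mul_row_col trmx0 map_mx0 mul0mx mulmx0.
  by rewrite addr0 mxE.
by rewrite Lw -[0 in RHS]col_mx0 => /eq_col_mx[].
Qed.

(** Taking adjoints in the range inclusion solves the gain equation. *)
Lemma gain_set_nonempty (n m : nat) (L : 'M[C]_(n + m)) : psdmx L ->
  exists K, gain_set L K.
Proof.
move=> Lpsd; set D := drsubmx L; set U := ursubmx L.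
have DH : D ^t* = D.
  rewrite /D -{2}(herm_ctmx Lpsd.1) -{2}[L]submxK tr_block_mx map_block_mx.
  by rewrite block_mxKdr.
exists (- ((pseudoinv D) ^t* *m U ^t*)); rewrite /gain_set /= -/D -/U mulmxN.
by rewrite -{1}DH -!ctmxM psd_block_range// addNr.
Qed.

(** The gain equation kills the lower block of L [I; K], and the vanishing Schur
complement then kills the upper one; the feedback matrix is
[I; K] X_1 [I; K]^*. *)
Lemma inner_feedback0 (n m : nat) (L : 'M[C]_(n + m)) (K : 'M[C]_(m, n))
    (X1 : 'M[C]_n) :
  psdmx L -> schur L = 0 -> gain_set L K -> X1 \is hermsymmx ->
  inner L (feedback K X1) = 0.
Proof.
move=> Lpsd schur0 LK X1H; set D := drsubmx L; set U := ursubmx L.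
set N : 'M[C]_(n + m, n) := col_mx 1%:M K.
have fE : (feedback K X1) ^t* = N *m (X1 *m N ^t*).
  rewrite /feedback /N tr_block_mx map_block_mx trmxCK tr_col_mx map_row_mx.
  rewrite trmx1 map_mx1 mul_mx_row mulmx1 mul_col_row !mul1mx.
  by rewrite !ctmxM trmxCK herm_ctmx.
have dl : dlsubmx L = U ^t*.
  rewrite /U -{1}(herm_ctmx Lpsd.1) -{1}[L]submxK tr_block_mx map_block_mx.
  by rewrite block_mxKdl.
have DK : D *m K = - U ^t* by apply/eqP; rewrite -addr_eq0; apply/eqP.
have LN : L *m N = 0.
  rewrite -[L]submxK mul_block_col !mulmx1 dl DK subrr.
  have -> : ulsubmx L = U *m pseudoinv D *m U ^t*.
    by apply/eqP; rewrite -subr_eq0; apply/eqP.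
  rewrite -/U -[X in _ + X *m K](psd_block_range Lpsd) -/U -/D.
  by rewrite -(mulmxA _ D K) DK mulmxN subrr col_mx0.
by rewrite /inner fE mulmxA LN mul0mx mxtrace0.
Qed.

Lemma innerDl (p : nat) (A B X : 'M[C]_p) :
  inner (A + B) X = inner A X + inner B X.
Proof. by rewrite /inner mulmxDl !raddfD. Qed.

Lemma innerNl (p : nat) (A X : 'M[C]_p) : inner (- A) X = - inner A X.
Proof. by rewrite /inner mulNmx !raddfN. Qed.

Lemma inner_coord (p : nat) (A X : 'M[C]_p) : inner A X =
  \sum_i \sum_j (complex.Re (A i j) * complex.Re (X i j) +
                 complex.Im (A i j) * complex.Im (X i j)).
Proof.
rewrite /inner /mxtrace raddf_sum; apply: eq_bigr => i _.
rewrite mxE raddf_sum; apply: eq_bigr => j _; rewrite !mxE.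
by case: (A i j) => a b; case: (X i j) => c d /=; rewrite mulrN opprK.
Qed.

Lemma innerE_state (n m : nat) (P : 'M[C]_n) (X : 'M[C]_(n + m)) :
  inner ((Emx R n m) ^t* *m P *m Emx R n m) X = inner P (state_block X).
Proof.
rewrite /inner /state_block -!mulmxA mxtrace_mulC -mulmxA !ctmxM trmxCK.
by rewrite -!mulmxA.
Qed.

(** Spectral theorem: in an eigenbasis of P the trace of P X is the sum of the
eigenvalues of P weighted by the diagonal entries of X. *)
Lemma inner_psd_ge0 (p : nat) (P X : 'M[C]_p) : psdmx P -> psdmx X ->
  0 <= inner P X.
Proof.
move=> [hP P0] [hX X0].
have /orthomx_spectralP := hermitian_normalmx hP.
have := spectral_unitarymx P.
set Q := spectralmx P; set d := spectral_diag P => uQ PE.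
have QV := invmx_unitary uQ; rewrite QV in PE.
have QQ : Q *m Q ^t* = 1%:M by apply/unitarymxP.
have diagE (M : 'M[C]_p) k : (Q *m M *m Q ^t*) k k =
    ((row k Q) ^t* ^t* *m M *m (row k Q) ^t*) 0 0.
  rewrite trmxCK -row_mul !mxE; apply: eq_bigr => l _.
  by rewrite !mxE.
have d0 k : 0 <= d 0 k.
  have -> : d 0 k = (Q *m P *m Q ^t*) k k.
    rewrite PE !mulmxA QQ mul1mx -!mulmxA QQ mulmx1.
    by rewrite mxE eqxx mulr1n.
  by rewrite diagE.
suff : 0 <= \tr (P *m X ^t*).
  by rewrite /inner; case: (\tr _) => a b; rewrite lecE => /andP[].
rewrite (herm_ctmx hX) {1}PE -!mulmxA mxtrace_mulC -!mulmxA.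
rewrite mul_diag_mx /mxtrace; apply: sumr_ge0 => k _.
by rewrite mxE mulr_ge0// mulmxA diagE.
Qed.

Lemma psd_state_block (n m : nat) (X : 'M[C]_(n + m)) :
  psdmx X -> psdmx (state_block X).
Proof.
move=> [hX X0]; split.
  apply/is_hermitianmxP; rewrite expr0 scale1r /state_block.
  by rewrite !ctmxM trmxCK (herm_ctmx hX) mulmxA.
move=> v; have := X0 ((Emx R n m) ^t* *m v).
by rewrite ctmxM trmxCK /state_block !mulmxA.
Qed.

End linear_algebra.

(** * Absolutely continuous functions *)

Section primitives.
Variable R : realType.
Local Notation mu := (@lebesgue_measure R).
Implicit Types (a b c : R) (f g F G : R -> R).

(** An absolutely continuous F with a chosen representative f of its almost
everywhere derivative. The flow equation gives the state in this form. *)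
Definition primitive a b F f :=
  mu.-integrable `[a, b] (EFin \o f) /\
  forall s, a <= s <= b -> F s = F a + \int[mu]_(u in `[a, s]) f u.

(** The half-open interval matches the strict inequality used to cut out the
triangle in the exchange of integrals below. *)
Lemma primitive_increment a b F f c d : a <= c -> c <= d -> d <= b ->
  primitive a b F f -> F d - F c = \int[mu]_(u in `]c, d]) f u.
Proof.
move=> ac cd db [If Ff].
have Id : mu.-integrable `[a, d] (EFin \o f).
  by apply: integrableS If => //; apply: subset_itv; rewrite bnd_simp.
rewrite Ff ?(le_trans ac)//.
rewrite [in X in _ - X]Ff ?ac ?(le_trans cd)//.
by rewrite opprD addrACA subrr add0r Rintegral_itvB ?bnd_simp.
Qed.

Lemma primitive_sub a b c d F f : a <= c -> c <= d -> d <= b ->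
  primitive a b F f -> primitive c d F f.
Proof.
move=> ac cd db pF.
have I s : s <= d -> mu.-integrable `[c, s] (EFin \o f).
  move=> sd; apply: integrableS pF.1 => //.
  apply: subset_itv; rewrite bnd_simp//.
  exact: le_trans db.
split=> [|s /andP[cs sd]]; first exact: I.
apply/eqP; rewrite addrC -subr_eq; apply/eqP.
rewrite (primitive_increment ac cs _ pF) ?(le_trans sd)//.
rewrite Rintegral_itv_obnd_cbnd//; apply: integrableS (I _ sd) => //.
by apply: subset_itv; rewrite bnd_simp.
Qed.

Lemma primitive_cat a b c F f : a <= b -> b <= c ->
  primitive a b F f -> primitive b c F f -> primitive a c F f.
Proof.
move=> ab bc [Iab Fab] [Ibc Fbc].
have Iac : mu.-integrable `[a, c] (EFin \o f).
  have Ebc : `[a, c]%classic = `[a, b] `|` `]b, c].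
    by rewrite (@itv_bndbnd_setU _ _ _ (BRight b)) ?bnd_simp.
  have Ibc' : mu.-integrable `]b, c] (EFin \o f).
    by apply: integrableS Ibc => //; apply: subset_itvr; rewrite bnd_simp.
  case/integrableP: Iab => mab iab; case/integrableP: Ibc' => mbc ibc.
  rewrite Ebc; apply/integrableP; split; first exact/measurable_funU.
  rewrite ge0_integral_setU//; first exact: lte_add_pinfty.
    by apply: measurableT_comp => //; exact/measurable_funU.
  apply/disj_setPS => x/= []; rewrite !in_itv/= => /andP[_ xb] /andP[bx _].
  by have := lt_le_trans bx xb; rewrite ltxx.
split => // s /andP[as_ sc].
have [sb|bs] := leP s b; first by apply: Fab; rewrite as_.
have Is : mu.-integrable `[a, s] (EFin \o f).
  by apply: integrableS Iac => //; apply: subset_itv; rewrite bnd_simp.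
rewrite Fbc ?(ltW bs)// Fab ?ab ?lexx// -addrA; congr (_ + _).
apply/eqP; rewrite addrC eq_sym -subr_eq; apply/eqP.
rewrite Rintegral_itvB ?bnd_simp ?(ltW bs)// Rintegral_itv_obnd_cbnd//.
by apply: integrableS Is => //; apply: subset_itv; rewrite bnd_simp.
Qed.

(** The density f(s) g(u), restricted to the triangle s < u. *)
Let tri (f g : R -> R) (z : R * R) : R :=
  if z.1 < z.2 then f z.1 * g z.2 else 0.

Let integrable_tri f g : mu.-integrable setT (EFin \o f) ->
  mu.-integrable setT (EFin \o g) ->
  (mu \x mu)%E.-integrable setT (EFin \o tri f g).
Proof.
move=> If Ig.
have mf : measurable_fun setT f by apply/measurable_EFinP; case/integrableP: If.
have mg : measurable_fun setT g by apply/measurable_EFinP; case/integrableP: Ig.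
have mfg : measurable_fun setT (tri f g).
  apply: measurable_fun_ifT => //.
    by apply: measurable_fun_ltr; [exact: measurable_fst|exact: measurable_snd].
  apply: measurable_funM.
    by apply: measurableT_comp => //; exact: measurable_fst.
  by apply: measurableT_comp => //; exact: measurable_snd.
apply/integrable12ltyP; first exact/measurable_EFinP.
case/integrableP: If => _ If; case/integrableP: Ig => _ Ig.
have mnf : measurable_fun setT (fun x => `|(f x)%:E|%E).
  by apply: measurableT_comp => //; exact/measurable_EFinP.
have mng : measurable_fun setT (fun x => `|(g x)%:E|%E).
  by apply: measurableT_comp => //; exact/measurable_EFinP.
apply: (@le_lt_trans _ _ (\int[mu]_x (`|(f x)%:E| * \int[mu]_y `|(g y)%:E|))%E).
  apply: ge0_le_integral => //.
  - by move=> x _; apply: integral_ge0.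
  - apply: (@measurable_fun_fubini_tonelli_F _ _ _ _ R mu
      (fun z => `|(tri f g z)%:E|%E)) => //.
    by apply: measurableT_comp => //; exact/measurable_EFinP.
  - by apply: emeasurable_funM.
  - move=> x _; rewrite -ge0_integralZl//.
      apply: ge0_le_integral => //.
      + apply: measurableT_comp => //; apply/measurable_EFinP.
        exact: measurableT_comp mfg (measurable_pair1 x).
      + by apply: emeasurable_funM.
      + move=> y _ /=; rewrite lee_fin /tri/=.
        by case: ifP => _; rewrite ?normrM// normr0 mulr_ge0.
rewrite ge0_integralZr//; last exact: integral_ge0.
by rewrite lte_mul_pinfty ?integral_ge0// ge0_fin_numE ?integral_ge0.
Qed.

Let fubini_tri a b f g G : primitive a b G g ->
  (fun s => \int[mu]_u (tri (f \_ `[a, b]) (g \_ `[a, b]) (s, u))%:E)%E =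
  ((fun s => (f s * (G b - G s))%:E) \_ `[a, b])%E.
Proof.
move=> pG; apply/funext => s; rewrite patchE.
case: ifPn => [|sab]; last first.
  rewrite integral0_eq// => y _; rewrite /tri /=; case: ifP => // _.
  by rewrite patchE (negPf sab) mul0r.
rewrite inE/= in_itv/= => sab; case/andP: (sab) => as_ sb.
rewrite (primitive_increment as_ sb _ pG)//.
have Ig : mu.-integrable `]s, b] (EFin \o g).
  by apply: integrableS pG.1 => //; apply: subset_itv; rewrite bnd_simp.
rewrite EFinM [X in (_ * X)%E]fineK; last exact: integrable_fin_num.
rewrite -integralZl// integral_mkcond; apply: eq_integral => y _ /=.
rewrite /tri /= !patchE /= !mem_setE !in_itv/= as_ sb/=.
have [sy|//] := ltP s y; rewrite (le_trans as_ (ltW sy))/=.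
by case: (y <= b); rewrite ?mulr0.
Qed.

Let fubini_tri_swap a b F f g : primitive a b F f ->
  (fun u => \int[mu]_s (tri (f \_ `[a, b]) (g \_ `[a, b]) (s, u))%:E)%E =
  ((fun s => (g s * (F s - F a))%:E) \_ `[a, b])%E.
Proof.
move=> pF; apply/funext => s; rewrite patchE.
case: ifPn => [|sab]; last first.
  rewrite integral0_eq// => y _; rewrite /tri /=; case: ifP => // _.
  by rewrite [X in (_ * X)%:E]patchE (negPf sab) mulr0.
rewrite inE/= in_itv/= => sab; case/andP: (sab) => as_ sb.
have If : mu.-integrable `[a, s[ (EFin \o f).
  by apply: integrableS pF.1 => //; apply: subset_itv; rewrite bnd_simp.
rewrite pF.2// addrAC subrr add0r -Rintegral_itv_bndo_bndc//.
rewrite EFinM [X in (_ * X)%E]fineK; last exact: integrable_fin_num.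
rewrite -integralZl// integral_mkcond; apply: eq_integral => y _ /=.
rewrite /tri /= !patchE /= !mem_setE !in_itv/= as_ sb/= mulrC.
have [ys|sy] := ltP y s; last by rewrite andbF.
by rewrite (le_trans (ltW ys) sb) andbT; case: (a <= y); rewrite ?mulr0.
Qed.

Let integrable_tri_itv a b F f G g : primitive a b F f -> primitive a b G g ->
  (mu \x mu)%E.-integrable setT (EFin \o tri (f \_ `[a, b]) (g \_ `[a, b])).
Proof.
move=> pF pG; apply: integrable_tri.
  by rewrite -restrict_EFin -integrable_mkcond//; exact: pF.1.
by rewrite -restrict_EFin -integrable_mkcond//; exact: pG.1.
Qed.

Let integrable_Zr a b f k : mu.-integrable `[a, b] (EFin \o f) ->
  mu.-integrable `[a, b] (EFin \o (fun x => f x * k)).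
Proof.
move=> If.
have -> : EFin \o (fun x => f x * k) = (fun x => k%:E * (EFin \o f) x)%E.
  by apply/funext => x /=; rewrite mulrC EFinM.
exact: integrableZl.
Qed.

(** A by-product of Fubini: the inner integral of an integrable function of two
variables is integrable, and here it is f (G(b) - G). *)
Lemma primitive_integrable_mul a b F f G g :
  primitive a b F f -> primitive a b G g ->
  mu.-integrable `[a, b] (EFin \o (fun s => f s * G s)).
Proof.
move=> pF pG.
have IfG : mu.-integrable `[a, b] (EFin \o (fun s => f s * (G b - G s))).
  apply/integrable_mkcond => //; rewrite -(fubini_tri f pG).
  exact: integrable_fubini_F (integrable_tri_itv pF pG).
have -> : EFin \o (fun s => f s * G s) =
    (fun s => (f s * G b)%:E - (f s * (G b - G s))%:E)%E.
  by apply/funext => s /=; rewrite -EFinB; congr EFin; ring.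
by apply: integrableB => //; exact/integrable_Zr/(proj1 pF).
Qed.

(** Integrating f(s) g(u) over the triangle a <= s < u <= b in the two possible
orders gives the integral of f (G(b) - G) and the integral of g (F - F(a)). *)
Lemma primitive_exchange a b F f G g :
  primitive a b F f -> primitive a b G g ->
  \int[mu]_(s in `[a, b]) (f s * (G b - G s)) =
  \int[mu]_(s in `[a, b]) (g s * (F s - F a)).
Proof.
move=> pF pG; have Itri := integrable_tri_itv pF pG.
rewrite /Rintegral [in LHS]integral_mkcond [in RHS]integral_mkcond; congr fine.
rewrite -(fubini_tri f pG) -(fubini_tri_swap g pF); exact: Fubini Itri.
Qed.

(** Product rule for absolutely continuous functions: the exchange identity on
each [a, s] is integration by parts there. *)
Lemma primitive_mul a b F f G g : primitive a b F f -> primitive a b G g ->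
  primitive a b (fun s => F s * G s) (fun s => f s * G s + F s * g s).
Proof.
move=> pF pG.
have IfG := primitive_integrable_mul pF pG.
have IFg : mu.-integrable `[a, b] (EFin \o (fun s => F s * g s)).
  have -> : (fun s => F s * g s) = (fun s => g s * F s).
    by apply/funext => s; rewrite mulrC.
  exact: primitive_integrable_mul pG pF.
split; first by have := integrableD _ IfG IFg; apply.
move=> s /andP[as_ sb].
have S : `[a, s] `<=` `[a, b] by apply: subset_itv; rewrite bnd_simp.
have pFs := primitive_sub (lexx a) as_ sb pF.
have pGs := primitive_sub (lexx a) as_ sb pG.
have := primitive_exchange pFs pGs.
under eq_Rintegral do rewrite mulrBr.
under [in RHS]eq_Rintegral do rewrite mulrBr.
have IfGs : mu.-integrable `[a, s] (EFin \o (fun x => f x * G x)).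
  exact: integrableS IfG.
have IFgs : mu.-integrable `[a, s] (EFin \o (fun x => F x * g x)).
  exact: integrableS IFg.
have Igs : mu.-integrable `[a, s] (EFin \o (fun x => g x * F x)).
  exact: primitive_integrable_mul pGs pFs.
rewrite !RintegralB ?integrable_Zr//; [|exact: pGs.1|exact: pFs.1].
rewrite !RintegralZr//; [|exact: pGs.1|exact: pFs.1].
rewrite RintegralD//.
have -> : \int[mu]_(x in `[a, s]) (g x * F x) =
    \int[mu]_(x in `[a, s]) (F x * g x).
  by apply: eq_Rintegral => x _; rewrite mulrC.
have -> : \int[mu]_(x in `[a, s]) f x = F s - F a.
  by rewrite pF.2 ?as_// addrAC subrr add0r.
have -> : \int[mu]_(x in `[a, s]) g x = G s - G a.
  by rewrite pG.2 ?as_// addrAC subrr add0r.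
by move=> E; lra.
Qed.

End primitives.

(** * Piecewise continuously differentiable functions *)

Section piecewise.
Variable R : realType.
Local Notation mu := (@lebesgue_measure R).
Implicit Types (a b c u : R) (f g F G : R -> R).

(** Constant outside the interval, so that the one-sided limits at the end
points become values of a globally continuous function. *)
Definition extend a b g s : R :=
  if s <= a then lim (g x @[x --> a^'+]) else
  if b <= s then lim (g x @[x --> b^'-]) else g s.

Lemma extend_in a b g s : a < s < b -> extend a b g s = g s.
Proof. by move=> /andP[/lt_geF as_ /lt_geF sb]; rewrite /extend as_ sb. Qed.

Let cvg_near_eq (H : set_system R) (FH : Filter H) f g (l : R) :
  f x @[x --> H] --> l -> (\forall y \near H, f y = g y) ->
  g x @[x --> H] --> l.
Proof. by move=> fl fg; apply: cvg_trans fl; apply: near_eq_cvg. Qed.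

Lemma extend_continuous a b g : a < b -> {in `]a, b[, continuous g} ->
  cvg (g x @[x --> a^'+]) -> cvg (g x @[x --> b^'-]) ->
  continuous (extend a b g).
Proof.
move=> ab gc ga gb x; apply/left_right_continuousP; split.
- have [xa|ax] := leP x a.
    rewrite {2}/extend xa.
    apply: (@cvg_near_eq _ _ (cst _)); first exact: cvg_cst.
    near=> y; rewrite /extend ifT//; apply: le_trans xa.
    by near: y; exact: nbhs_left_le.
  have [bx|xb|xb] := ltgtP b x.
  + rewrite {2}/extend leNgt ax /= (ltW bx).
    apply: (@cvg_near_eq _ _ (cst _)); first exact: cvg_cst.
    near=> y.
    have by_ : b < y by near: y; exact: nbhs_left_gt.
    by rewrite /extend leNgt (lt_trans ab by_) /= (ltW by_).
  + rewrite [X in _ --> X](@extend_in a b) ?ax//.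
    have xab : x \in `]a, b[ by rewrite in_itv/= ax.
    have := cvg_at_left_filter (gc x xab).
    move/cvg_near_eq; apply; near=> y; apply/esym/extend_in; apply/andP; split.
      by near: y; exact: nbhs_left_gt.
    by apply: lt_trans xb; near: y; exact: nbhs_left_lt.
  + rewrite -xb {2}/extend leNgt ab /= lexx; move/cvg_near_eq: gb; apply.
    near=> y; apply/esym/extend_in; apply/andP; split.
      by near: y; exact: nbhs_left_gt.
    by near: y; exact: nbhs_left_lt.
- have [bx|xb] := leP b x.
    rewrite {2}/extend leNgt (lt_le_trans ab bx) /= bx.
    apply: (@cvg_near_eq _ _ (cst _)); first exact: cvg_cst.
    near=> y.
    have xy : x <= y by near: y; exact: nbhs_right_ge.
    by rewrite /extend leNgt (lt_le_trans ab) ?(le_trans bx)//= (le_trans bx).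
  have [xa|ax|xa] := ltgtP x a.
  + rewrite {2}/extend (ltW xa).
    apply: (@cvg_near_eq _ _ (cst _)); first exact: cvg_cst.
    near=> y; rewrite /extend ifT//.
    by near: y; exact: nbhs_right_le.
  + rewrite [X in _ --> X](@extend_in a b) ?ax//.
    have xab : x \in `]a, b[ by rewrite in_itv/= ax.
    have := cvg_at_right_filter (gc x xab).
    move/cvg_near_eq; apply; near=> y; apply/esym/extend_in; apply/andP; split.
      by apply: lt_trans ax _; near: y; exact: nbhs_right_gt.
    by near: y; exact: nbhs_right_lt.
  + rewrite xa {2}/extend lexx; move/cvg_near_eq: ga; apply.
    near=> y; apply/esym/extend_in; apply/andP; split.
      by near: y; exact: nbhs_right_gt.
    by near: y; exact: nbhs_right_lt.
Unshelve. all: by end_near. Qed.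

Lemma integrable_itv_cc a b f : mu.-integrable `]a, b[ (EFin \o f) ->
  mu.-integrable `[a, b] (EFin \o f).
Proof.
case/integrableP => /measurable_EFinP mf iff.
have mc : measurable_fun `[a, b] f := measurable_fun_itv_cc mf.
have mo : measurable_fun `]a, b] f := measurable_fun_itv_oc mf.
apply/integrableP; split; first exact/measurable_EFinP.
rewrite -integral_itv_obnd_cbnd; last first.
  by apply: measurableT_comp => //; exact/measurable_EFinP.
rewrite -integral_itv_bndo_bndc//.
by apply: measurableT_comp => //; exact/measurable_EFinP.
Qed.

(** End points are negligible, so a derivative that is only known inside a piece
may be replaced there by any other representative. *)
Lemma primitive_eq_oo a b F f h : (forall s, a < s < b -> h s = f s) ->
  primitive a b F h -> primitive a b F f.
Proof.
move=> hf [Ih Fh].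
have Io s : s <= b -> mu.-integrable `]a, s[ (EFin \o h).
  move=> sb; apply: integrableS Ih => //.
  by apply: subset_itv; rewrite bnd_simp.
have hfs s : s <= b -> {in `]a, s[%classic, h =1 f}.
  move=> sb x; rewrite inE/= in_itv/= => /andP[ax xs].
  by rewrite hf// ax (lt_le_trans xs).
have If s : s <= b -> mu.-integrable `]a, s[ (EFin \o f).
  by move=> sb; apply: eq_integrable (Io s sb) => // x /(hfs s sb) /= ->.
split; first exact: integrable_itv_cc (If b (lexx b)).
move=> s /andP[as_ sb]; rewrite Fh ?as_//; congr (_ + _).
have I2 f' : mu.-integrable `]a, s[ (EFin \o f') ->
    \int[mu]_(x in `[a, s]) f' x = \int[mu]_(x in `]a, s[) f' x.
  move=> /[dup] /integrable_itv_cc Ic Io'.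
  rewrite -Rintegral_itv_obnd_cbnd ?Rintegral_itv_bndo_bndc//.
  by apply: integrableS Ic => //; apply: subset_itv; rewrite bnd_simp.
rewrite !I2 ?Io ?If//; apply: eq_Rintegral; exact: hfs.
Qed.

(** The fundamental theorem of calculus for the continuous extensions of g and
of its derivative. The shift by u carries a function of the timer to one of
absolute time. *)
Lemma C1_piece_primitive a b g u : a < b -> C1_piece a b g ->
  primitive (a + u) (b + u) (fun s => extend a b g (s - u))
    (fun s => derive1 g (s - u)).
Proof.
move=> ab [dg cdg [ga gb] [dga dgb]].
set G := fun s => extend a b g (s - u).
pose h s := extend a b (derive1 g) (s - u).
have shiftc : continuous (fun s => s - u).
  by move=> s; apply: cvgB; [exact: cvg_id|exact: cvg_cst].
have hc : continuous h.
  move=> s; apply: (@continuous_comp _ _ _ (fun s => s - u) (extend a b _)).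
    exact: shiftc.
  exact: (extend_continuous ab cdg dga dgb).
have gc : {in `]a, b[, continuous g}.
  by move=> s /dg /derivable1_diffP /differentiable_continuous.
have Gc : continuous G.
  move=> s; apply: (@continuous_comp _ _ _ (fun s => s - u) (extend a b _)).
    exact: shiftc.
  exact: (extend_continuous ab gc ga gb).
have dG s : a + u < s < b + u -> is_derive s 1 G (h s).
  move=> su; have sab : a < s - u < b by rewrite ltrBrDr ltrBlDr.
  have -> : h s = derive1 g (s - u) * 1 by rewrite mulr1 /h extend_in.
  have dshift : is_derive s 1 (fun s => s - u) 1.
    by rewrite -[X in is_derive _ _ _ X]subr0; apply: is_deriveB.
  have dext : is_derive (s - u) 1 (extend a b g) (derive1 g (s - u)).
    apply: (@near_eq_is_derive _ _ _ g).
      have := @near_in_itvoo _ a b (s - u); rewrite in_itv/= => /(_ sab).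
      by apply: filterS => y; rewrite in_itv/= => /extend_in.
    apply: DeriveDef; first by apply: dg; rewrite in_itv.
    by rewrite derive1E.
  exact: (is_derive1_comp (f := extend a b g) (g := fun s => s - u)).
have FTC c d : a + u <= c -> c < d -> d <= b + u ->
    G d = G c + \int[mu]_(s in `[c, d]) h s.
  move=> ac cd db.
  have wh : {within `[c, d], continuous h} by exact: continuous_subspaceT.
  have inside s : s \in `]c, d[ -> a + u < s < b + u.
    rewrite in_itv/= => /andP[cs sd].
    by rewrite (le_lt_trans ac cs) (lt_le_trans sd db).
  have dGcd : derivable_oo_LRcontinuous G c d.
    split; [|exact/cvg_at_right_filter/Gc|exact/cvg_at_left_filter/Gc].
    by move=> s /inside /dG [].
  have dGE : {in `]c, d[, derive1 G =1 h}.
    by move=> s /inside /dG [_ <-]; rewrite derive1E.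
  have FTC2 := continuous_FTC2 cd wh dGcd dGE.
  by rewrite /Rintegral FTC2 -EFinB [fine _]/= addrC subrK.
have hE s : a + u < s < b + u -> h s = derive1 g (s - u).
  by move=> sab; rewrite /h extend_in// ltrBrDr ltrBlDr.
apply: primitive_eq_oo hE _; split.
  apply: continuous_compact_integrable; first exact: segment_compact.
  exact: continuous_subspaceT.
move=> s /andP[]; rewrite le_eqVlt => /predU1P[<-|as_] sb.
  by rewrite set_itv1 Rintegral_set1 addr0.
exact: FTC.
Qed.

Lemma extend_left T (g : R -> R) tau : 0 < tau <= T ->
  {within `]0, T[, continuous g} ->
  extend 0 T g tau = lim (g x @[x --> tau^'-]).
Proof.
move=> /andP[tau0]; rewrite le_eqVlt => /predU1P[<-|tauT] gc.
  by rewrite /extend lexx leNgt tau0.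
rewrite extend_in ?tau0//; apply/esym/cvg_lim => //; apply: cvg_at_left_filter.
move: gc; rewrite continuous_open_subspace//; apply.
by rewrite inE/= in_itv/= tau0.
Qed.

End piecewise.

Section gluing.
Variable R : realType.
Implicit Types (a b c u : R) (f g F G : R -> R).

Lemma primitive_point a F f : primitive a a F f.
Proof.
split=> [|s]; last first.
  by rewrite -eq_le => /eqP <-; rewrite set_itv1 Rintegral_set1 addr0.
rewrite set_itv1; apply/integrableP; split.
  by apply/measurable_EFinP; exact: measurable_fun_set1.
by rewrite integral_set1 ltry.
Qed.

Lemma eq_primitive a b F G f : a <= b -> (forall s, a <= s <= b -> F s = G s) ->
  primitive a b F f -> primitive a b G f.
Proof.
move=> ab FG [If Ff]; split=> // s sab.
by rewrite -!FG ?lexx ?ab//; exact: Ff.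
Qed.

Lemma primitiveD a b F f G g : primitive a b F f -> primitive a b G g ->
  primitive a b (fun s => F s + G s) (fun s => f s + g s).
Proof.
move=> [If Ff] [Ig Gg]; split; first by have := integrableD _ If Ig; apply.
move=> s sab; have /andP[as_ sb] := sab.
have S : `[a, s] `<=` `[a, b] by apply: subset_itv; rewrite bnd_simp.
rewrite RintegralD//; [|exact: integrableS If|exact: integrableS Ig].
by rewrite Ff// Gg// addrACA.
Qed.

Lemma primitive_sum (I : Type) (r : seq I) a b (F f : I -> R -> R) :
  (forall i, primitive a b (F i) (f i)) ->
  primitive a b (fun s => \sum_(i <- r) F i s) (fun s => \sum_(i <- r) f i s).
Proof.
have E (h : I -> R -> R) i r' : (fun s => \sum_(j <- i :: r') h j s) =
    (fun s => h i s + \sum_(j <- r') h j s).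
  by apply/funext => s; rewrite big_cons.
have E0 (h : I -> R -> R) : (fun s => \sum_(j <- [::]) h j s) = cst 0.
  by apply/funext => s; rewrite big_nil.
move=> Ff; elim: r => [|i r IH]; last by rewrite !E; exact: primitiveD.
rewrite !E0; split; first exact: integrable0.
by move=> s _; rewrite /cst /= /Rintegral integral0 addr0.
Qed.

(** Pieces can be glued because g is continuous at the inner break points: there
the limits that define the extension of one piece are values of g. *)
Lemma piecewise_primitive (T u : R) g (N : nat) (s : nat -> R) : 0 < T ->
  {within `]0, T[, continuous g} -> s 0%N = 0 -> s N = T ->
  (forall i, (i < N)%N -> s i < s i.+1 /\ C1_piece (s i) (s i.+1) g) ->
  continuous (extend 0 T g) /\
  primitive u (T + u) (fun x => extend 0 T g (x - u))
    (fun x => derive1 g (x - u)).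
Proof.
move=> T0 gc s0 sN sC.
have N0 : (0 < N)%N by case: N sN {sC} => // sN; move: T0; rewrite -sN s0 ltxx.
have {}gc : {in `]0, T[, continuous g}.
  move: gc; rewrite continuous_open_subspace// => gc x xT.
  by apply: gc; rewrite inE.
have ext_c : continuous (extend 0 T g).
  apply: extend_continuous => //.
  - by have [_ [_ _ [+ _] _]] := sC _ N0; rewrite s0.
  - have [] := sC N.-1; rewrite ?prednK// sN.
    by move=> _ [_ _ [_ +] _].
split=> //.
have s_ge0 i : (i <= N)%N -> 0 <= s i.
  elim: i => [|i IH] iN; first by rewrite s0.
  by rewrite (le_trans (IH (ltnW iN)))// ltW// (sC _ iN).1.
have s_leT i : (i <= N)%N -> s i <= T.
  move=> iN; rewrite -(subKn iN); elim: (N - i)%N (leq_subr i N) => [|j IH] jN.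
    by rewrite subn0 sN.
  apply: le_trans (IH (ltnW jN)); rewrite subnS.
  have := (sC (N - j).-1 _).1; rewrite prednK ?subn_gt0// => /(_ _)/ltW; apply.
  by rewrite leq_subr.
suff H k : (k <= N)%N -> primitive u (s k + u)
    (fun x => extend 0 T g (x - u)) (fun x => derive1 g (x - u)).
  by have := H N (leqnn N); rewrite sN.
elim: k => [_|k IH kN]; first by rewrite s0 add0r; exact: primitive_point.
have [sk piece] := sC _ kN.
apply: (primitive_cat _ _ (IH (ltnW kN))); rewrite ?lerD2r ?(ltW sk)//.
  by rewrite lerDr s_ge0// ltnW.
apply: eq_primitive (C1_piece_primitive u sk piece).
  by rewrite lerD2r ltW.
have [dg _ [ga gb] _] := piece.
have pc : continuous (extend (s k) (s k.+1) g).
  apply: extend_continuous => // x /dg /derivable1_diffP.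
  exact: differentiable_continuous.
have same x : s k < x < s k.+1 -> extend (s k) (s k.+1) g x = extend 0 T g x.
  move=> /[dup] xs /andP[kx xk]; rewrite !extend_in//.
  by rewrite (le_lt_trans (s_ge0 k (ltnW kN)))// (lt_le_trans xk)// s_leT.
have close (H : set_system R) x : ProperFilter H -> H --> x ->
    (\forall y \near H, s k < y < s k.+1) ->
    extend (s k) (s k.+1) g x = extend 0 T g x.
  move=> PH Hx near_s.
  have cvgH (e : R -> R) : continuous e -> e y @[y --> H] --> e x.
    by move=> ec; apply: cvg_trans (ec x); exact: cvg_app.
  apply: (cvg_unique _ _ (cvgH _ ext_c)) => //.
  apply: cvg_trans (cvgH _ pc); apply: near_eq_cvg.
  by apply: filterS near_s => y /same.
move=> x /andP[kx xk].
have : s k <= x - u <= s k.+1 by rewrite lerBrDr lerBlDr kx.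
move: (x - u) => y; rewrite le_eqVlt => /andP[/predU1P[<-|ky]].
  move=> _; apply: (close _ _ (at_right_proper_filter _) (cvg_within _)).
  near=> z; apply/andP; split; near: z.
    exact: nbhs_right_gt.
  exact: nbhs_right_lt.
rewrite le_eqVlt => /predU1P[->|yk]; last by apply: same; rewrite ky.
apply: (close _ _ (at_left_proper_filter _) (cvg_within _)).
near=> z; apply/andP; split; near: z.
  exact: nbhs_left_gt.
exact: nbhs_left_lt.
Unshelve. all: by end_near. Qed.

End gluing.

(** * Matrix-valued functions *)

Section matrix_primitives.
Variable R : realType.
Local Notation C := (R[i]).
Implicit Types (a b : R).

Definition mx_extend (n : nat) (T : R) (P : R -> 'M[C]_n) (tau : R) : 'M[C]_n :=
  coordwise (fun g => extend 0 T g tau) P.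

Definition mx_primitive (p : nat) a b (A A' : R -> 'M[C]_p) :=
  forall i j,
    primitive a b (fun s => complex.Re (A s i j))
      (fun s => complex.Re (A' s i j)) /\
    primitive a b (fun s => complex.Im (A s i j))
      (fun s => complex.Im (A' s i j)).

(** In real coordinates the trace form is a sum of products, so the product rule
applies entry by entry. *)
Lemma primitive_inner (p : nat) a b (A A' B B' : R -> 'M[C]_p) :
  mx_primitive a b A A' -> mx_primitive a b B B' ->
  primitive a b (fun s => inner (A s) (B s))
    (fun s => inner (A' s) (B s) + inner (A s) (B' s)).
Proof.
move=> pA pB.
pose p_entry i j := primitiveD (primitive_mul (pA i j).1 (pB i j).1)
                               (primitive_mul (pA i j).2 (pB i j).2).
pose p_row i := primitive_sum (index_enum 'I_p) (p_entry i).
have := primitive_sum (index_enum 'I_p) p_row.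
congr (primitive a b _ _).
  by apply/funext => s; rewrite inner_coord.
apply/funext => s; rewrite !inner_coord -big_split; apply: eq_bigr => i _ /=.
by rewrite -big_split; apply: eq_bigr => j _ /=; ring.
Qed.

Lemma cvg_inner (p : nat) (H : set_system R) (FH : Filter H)
    (A B : R -> 'M[C]_p) (A0 B0 : 'M[C]_p) :
  (forall i j, complex.Re (A s i j) @[s --> H] --> complex.Re (A0 i j) /\
               complex.Im (A s i j) @[s --> H] --> complex.Im (A0 i j)) ->
  (forall i j, complex.Re (B s i j) @[s --> H] --> complex.Re (B0 i j) /\
               complex.Im (B s i j) @[s --> H] --> complex.Im (B0 i j)) ->
  inner (A s) (B s) @[s --> H] --> inner A0 B0.
Proof.
move=> cA cB; rewrite inner_coord; under eq_fun do rewrite inner_coord.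
apply: cvg_big => // [|i _]; first exact: add_continuous.
apply: cvg_big => // [|j _]; first exact: add_continuous.
apply: cvgD; apply: cvgM;
  [exact: (cA i j).1|exact: (cB i j).1|exact: (cA i j).2|exact: (cB i j).2].
Qed.
End matrix_primitives.

Section matrix_extension.
Variable R : realType.
Local Notation C := (R[i]).
Implicit Types (T u : R).

Lemma mx_extend_in (n : nat) T (P : R -> 'M[C]_n) tau : 0 < tau < T ->
  mx_extend T P tau = P tau.
Proof.
move=> tauT; apply/matrixP => i j; rewrite mxE !extend_in//.
by case: (P tau i j).
Qed.

Lemma mx_extend0 (n : nat) T (P : R -> 'M[C]_n) :
  mx_extend T P 0 = mx_lim 0^'+ P.
Proof. by apply/matrixP => i j; rewrite !mxE /extend lexx. Qed.

Lemma mx_extend_left (n : nat) T (P : R -> 'M[C]_n) tau : 0 < tau <= T ->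
  mx_continuous `]0, T[ P -> mx_extend T P tau = mx_lim tau^'- P.
Proof.
move=> tauT cP; apply/matrixP => i j; rewrite !mxE.
by rewrite !extend_left//; [exact: (cP i j).2|exact: (cP i j).1].
Qed.

Lemma between_breakpoints (N : nat) (s : nat -> R) tau :
  s 0%N < tau -> tau < s N -> (forall i, (i <= N)%N -> tau != s i) ->
  exists2 i, (i < N)%N & s i < tau < s i.+1.
Proof.
elim: N => [|N IH] s0 sN sD; first by have := lt_trans s0 sN; rewrite ltxx.
have [tN|Nt|E] := ltgtP tau (s N); last first.
- by have := sD N (leqnSn N); rewrite E eqxx.
- by exists N => //; rewrite Nt.
have [i iN si] := IH s0 tN (fun i iN => sD i (leqW iN)).
by exists i => //; exact: leqW.
Qed.

(** The break points include 0, so that excluding B also excludes the left end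
point. *)
Lemma piecewise_C1_derivable (n : nat) T (P : R -> 'M[C]_n) :
  piecewise_C1 T P ->
  exists B : set R, [/\ countable B, B 0 &
    forall tau, 0 < tau < T -> ~ B tau -> mx_derivable P tau].
Proof.
move=> [_ [N [s [s0 sN sC]]]].
exists (range s); split; [exact: card_image_le|by exists 0%N|].
move=> tau /andP[tau0 tauT] nB; have sD i : (i <= N)%N -> tau != s i.
  by move=> _; apply/eqP => tE; apply: nB; exists i.
rewrite -s0 in tau0; rewrite -sN in tauT.
have [i iN si] := between_breakpoints tau0 tauT sD.
have [_ pieces] := sC i iN.
by move=> k l; have [[d1 _ _ _] [d2 _ _ _]] := pieces k l; split;
  [apply: d1|apply: d2]; rewrite in_itv.
Qed.

Lemma mx_extend_primitive (n : nat) T u (P : R -> 'M[C]_n) :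
  0 < T -> piecewise_C1 T P ->
  (forall i j, continuous (fun x => complex.Re (mx_extend T P x i j)) /\
               continuous (fun x => complex.Im (mx_extend T P x i j))) /\
  mx_primitive u (T + u) (fun x => mx_extend T P (x - u))
    (fun x => mx_deriv P (x - u)).
Proof.
move=> T0 [cP [N [s [s0 sN sC]]]].
have H i j := @piecewise_primitive R T u _ N s T0 (cP i j).1 s0 sN
  (fun k kN => conj (sC k kN).1 ((sC k kN).2 i j).1).
have H' i j := @piecewise_primitive R T u _ N s T0 (cP i j).2 s0 sN
  (fun k kN => conj (sC k kN).1 ((sC k kN).2 i j).2).
have ReE i j : (fun x => complex.Re (mx_extend T P x i j)) =
    extend 0 T (fun x => complex.Re (P x i j)).
  by apply/funext => x; rewrite mxE.
have ImE i j : (fun x => complex.Im (mx_extend T P x i j)) =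
    extend 0 T (fun x => complex.Im (P x i j)).
  by apply/funext => x; rewrite mxE.
have ReD i j : (fun x => complex.Re (mx_deriv P x i j)) =
    derive1 (fun x => complex.Re (P x i j)) by apply/funext => x; rewrite mxE.
have ImD i j : (fun x => complex.Im (mx_deriv P x i j)) =
    derive1 (fun x => complex.Im (P x i j)) by apply/funext => x; rewrite mxE.
split=> i j.
  by rewrite ReE ImE; split; [exact: (H i j).1|exact: (H' i j).1].
split.
  have := (H i j).2; rewrite -ReE -ReD; exact.
have := (H' i j).2; rewrite -ImE -ImD; exact.
Qed.

End matrix_extension.

(** * Integrals over increasing domains *)

Section monotone_convergence.
Variable R : realType.
Local Notation mu := (@lebesgue_measure R).

Lemma ge0_integral_itv_cat (a b c : R) (g : R -> R) : a <= b -> b <= c ->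
  measurable_fun `[a, c[ g -> (forall s, a <= s < c -> 0 <= g s) ->
  (\int[mu]_(s in `[a, c[) (g s)%:E =
   \int[mu]_(s in `[a, b[) (g s)%:E + \int[mu]_(s in `[b, c[) (g s)%:E)%E.
Proof.
move=> ab bc mg g0.
have acE : `[a, c[%classic = `[a, b[ `|` `[b, c[.
  by rewrite (@itv_bndbnd_setU _ _ _ (BLeft b)) ?bnd_simp.
rewrite acE ge0_integral_setU// -?acE.
- exact/measurable_EFinP.
- by move=> s /=; rewrite in_itv/= lee_fin; exact: g0.
- apply/disj_setPS => x/= []; rewrite !in_itv/= => /andP[_ xb] /andP[bx _].
  by have := lt_le_trans xb bx; rewrite ltxx.
Qed.

Lemma integral_bnd_open_le (a b : R) (g : R -> R) (M : R) : a < b ->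
  measurable_fun `[a, b[ g -> (forall s, a <= s < b -> 0 <= g s) ->
  (forall c, a <= c < b -> (\int[mu]_(s in `[a, c]) (g s)%:E <= M%:E)%E) ->
  (\int[mu]_(s in `[a, b[) (g s)%:E <= M%:E)%E.
Proof.
move=> ab mg g0 gM.
have M0 : (0%:E <= M%:E)%E.
  by have := gM a; rewrite lexx ab set_itv1 integral_set1; apply.
have lt_b N : b - N.+1%:R^-1 < b by rewrite ltrBlDr ltrDl invr_gt0.
have sub N : `[a, b - N.+1%:R^-1] `<=` `[a, b[.
  by apply: subset_itvl; rewrite bnd_simp lt_b.
rewrite itv_bnd_open_bigcup.
apply: (cvge_to_le (ge0_nondecreasing_set_cvg_integral (mu := mu) _ _ _ _)).
- move=> i j ij; apply/subsetPset/subset_itvl; rewrite bnd_simp lerD2l lerN2.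
  by rewrite lef_pV2 ?posrE// ler_nat.
- by [].
- by move=> N; apply/measurable_EFinP; apply: measurable_funS mg.
- by move=> N s /sub /=; rewrite in_itv/= lee_fin; exact: g0.
near=> N; have [aN|Na] := leP a (b - N.+1%:R^-1).
  by apply: gM; rewrite aN lt_b.
by rewrite set_itv_ge ?integral_set0// bnd_simp -ltNge.
Unshelve. all: by end_near. Qed.

(** Monotone convergence for the integral and the series at the same time. *)
Lemma integral_series_le (t : nat -> R) (g : R -> R) (z : nat -> R) (M : R) :
  {homo t : i j / (i <= j)%N >-> i <= j} -> (forall x, exists k, x < t k) ->
  measurable_fun `[t 0%N, +oo[ g -> (forall s, t 0%N <= s -> 0 <= g s) ->
  (forall k, (0 < k)%N -> 0 <= z k) ->
  (forall N, (\int[mu]_(s in `[t 0%N, t N[) (g s)%:E +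
              \sum_(1 <= k < N.+1) (z k)%:E <= M%:E)%E) ->
  (\int[mu]_(s in `[t 0%N, +oo[) (g s)%:E +
   \sum_(1 <= k <oo) (z k)%:E <= M%:E)%E.
Proof.
move=> t_le t_ub mg g0 z0 leM.
have tU : \bigcup_N `[t 0%N, t N[%classic = `[t 0%N, +oo[%classic.
  apply/seteqP; split=> [s [N _] /=|s /=]; rewrite !in_itv/= ?andbT.
    by case/andP.
  by move=> s0; have [N sN] := t_ub s; exists N => //=; rewrite in_itv/= s0.
have cvg_int : (\int[mu]_(s in `[t 0%N, t N[) (g s)%:E)%E @[N --> \oo] -->
    (\int[mu]_(s in `[t 0%N, +oo[) (g s)%:E)%E.
  rewrite -tU; apply: (ge0_nondecreasing_set_cvg_integral (mu := mu)).
  - by move=> i j ij; apply/subsetPset/subset_itvl; rewrite bnd_simp t_le.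
  - by [].
  - move=> N; apply/measurable_EFinP; apply: measurable_funS mg => //.
    by apply: subset_itv; rewrite bnd_simp.
  - by move=> N s /=; rewrite in_itv/= => /andP[s0 _]; rewrite lee_fin g0.
have cvg_sum : (\sum_(1 <= k < N.+1) (z k)%:E)%E @[N --> \oo] -->
    (\sum_(1 <= k <oo) (z k)%:E)%E.
  rewrite (cvg_shiftS (fun N => \sum_(1 <= k < N) (z k)%:E)%E).
  by apply: is_cvg_nneseries => k k1 _; rewrite lee_fin z0.
apply: (cvge_to_le (cvgeD _ cvg_int cvg_sum)); last by near=> N; exact: leM.
apply: ge0_adde_def; rewrite inE.
  by apply: integral_ge0 => s /=; rewrite in_itv/= andbT lee_fin; exact: g0.
by apply: nneseries_ge0 => k k1 _; rewrite lee_fin z0.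
Unshelve. all: by end_near. Qed.

End monotone_convergence.

(** * The value along a closed-loop trajectory *)

Section closed_loop.
Variables (R : realType) (n m : nat) (S : hsystem R n m) (Tmin Tmax : R).
Variable P : R -> 'M[R[i]]_n.
Variables (K : R -> 'M[R[i]]_(m, n)) (Kj : nat -> R -> 'M[R[i]]_(m, n)).
Local Notation mu := (@lebesgue_measure R).
Hypothesis hS : standing_assumptions S.
Hypothesis Tmin_gt0 : 0 < Tmin.
Hypothesis Tmin_le : Tmin <= Tmax.
Hypothesis P_C1 : piecewise_C1 Tmax P.
Hypothesis P_psd : forall tau, tau \in `[0, Tmax] -> psdmx (P tau).
Hypothesis flow_eq : forall tau, tau \in `]0, Tmax[ -> mx_derivable P tau ->
  psdmx (CZ S P tau) /\ schur (CZ S P tau) = 0.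
Hypothesis jump_eq : forall (k : nat) tau, (1 <= k)%N ->
  tau \in `[Tmin, Tmax] ->
  psdmx (DZ S k (mx_lim 0^'+ P) (mx_lim tau^'- P)) /\
  schur (DZ S k (mx_lim 0^'+ P) (mx_lim tau^'- P)) = 0.
Hypothesis KP : gain_selection S Tmin Tmax P K Kj.

Let Tmax_gt0 : 0 < Tmax. Proof. exact: lt_le_trans Tmin_le. Qed.

Let Pe := mx_extend Tmax P.

(** The left-hand side is the time derivative of the value, and it differs from
minus the running cost by the pairing of C_Z with X, which the policy makes
zero. *)
Lemma flow_rate tau (X : 'M[R[i]]_(n + m)) : 0 < tau < Tmax ->
  mx_derivable P tau -> psdmx X -> X = feedback (K tau) (state_block X) ->
  inner (mx_deriv P tau) (state_block X) + inner (Pe tau) (Fmap S tau X) =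
  - inner (Zflow S tau) X.
Proof.
move=> tauT dP Xpsd Xfb.
have [Cpsd Cschur] := flow_eq (tauT : tau \in `]0, Tmax[) dP.
have CX : inner (CZ S P tau) X = 0.
  rewrite {1}Xfb; apply: inner_feedback0 => //; first exact: KP.1.
  exact: (psd_state_block Xpsd).1.
have tau_ge0 : 0 <= tau by case/andP: tauT => /ltW.
have Ptau : psdmx (P tau).
  by apply: P_psd; case/andP: tauT => /ltW t0 /ltW tT; rewrite in_itv/= t0.
rewrite /Pe mx_extend_in// ((Fmap_adjoint hS tau_ge0).2 _ _ Ptau.1 Xpsd.1).
by move: CX; rewrite /CZ !innerDl innerE_state => CX; lra.
Qed.

(** At 0 only the one-sided limit of P enters, and hermitian symmetry passes to
it by continuity of the extension. *)
Lemma extend_herm delta : 0 <= delta < Tmax -> Pe delta \is hermsymmx.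
Proof.
move=> /andP[d0 dT].
have [Pc _] := mx_extend_primitive 0 Tmax_gt0 P_C1.
have near_in : \forall x \near delta^'+, 0 < x < Tmax.
  near=> x; apply/andP; split; last first.
    by near: x; exact: nbhs_right_lt.
  by apply: le_lt_trans d0 _; near: x; exact: nbhs_right_gt.
have eq_lim (f g : R -> R) : continuous f -> continuous g ->
    (forall x, 0 < x < Tmax -> f x = g x) -> f delta = g delta.
  move=> fc gc fg; apply: (cvg_unique _ (cvg_at_right_filter (fc delta))) => //.
  apply: cvg_trans (cvg_at_right_filter (gc delta)); apply: near_eq_cvg.
  by apply: filterS near_in => x /fg.
have herm x : 0 < x < Tmax -> forall i j, Pe x i j = (Pe x j i)^*%C.
  move=> xT i j; rewrite /Pe mx_extend_in//.
  have [Ph _] : psdmx (P x).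
    by apply: P_psd; case/andP: xT => /ltW t0 /ltW tT; rewrite in_itv/= t0.
  by rewrite -[in LHS](herm_ctmx Ph) !mxE.
apply/is_hermitianmxP; rewrite expr0 scale1r; apply/matrixP => i j.
have -> : (map_mx Num.conj (Pe delta)^T) i j = (Pe delta j i)^*%C.
  by rewrite !mxE.
have [cRe cIm] := Pc i j; have [cRe' cIm'] := Pc j i.
have Re_eq : complex.Re (Pe delta i j) = complex.Re (Pe delta j i).
  apply: eq_lim cRe cRe' _ => x xT.
  by rewrite -/Pe (herm x xT i j); case: (Pe x j i).
have Im_eq : complex.Im (Pe delta i j) = - complex.Im (Pe delta j i).
  apply: (eq_lim _ (fun x => - complex.Im (Pe x j i)) cIm).
    by move=> x; apply: cvgN; exact: cIm'.
  by move=> x xT; rewrite -/Pe (herm x xT i j); case: (Pe x j i).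
move: Re_eq Im_eq; case: (Pe delta i j) => a b; case: (Pe delta j i) => c d.
by move=> /= -> ->.
Unshelve. all: by end_near. Qed.

(** Here the pairing of D_Z with the state before the jump vanishes: what the
value loses at the jump is exactly the jump cost. *)
Lemma jump_balance (k : nat) delta (Xm : 'M[R[i]]_(n + m)) : (0 < k)%N ->
  Tmin <= delta <= Tmax -> psdmx Xm ->
  Xm = feedback (Kj k delta) (state_block Xm) ->
  inner (Pe 0) (Jmap S k Xm) + inner (Zjump S k) Xm =
  inner (Pe delta) (state_block Xm).
Proof.
move=> k0 dT Xpsd Xfb.
have d0 : 0 < delta <= Tmax by case/andP: dT => /(lt_le_trans Tmin_gt0) -> ->.
have [Dpsd Dschur] := jump_eq k0 (dT : delta \in `[Tmin, Tmax]).
have DX : inner (DZ S k (mx_lim 0^'+ P) (mx_lim delta^'- P)) Xm = 0.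
  rewrite {1}Xfb; apply: inner_feedback0 => //; first exact: KP.2.
  exact: (psd_state_block Xpsd).1.
have P0_herm : Pe 0 \is hermsymmx by apply: extend_herm; rewrite lexx Tmax_gt0.
rewrite ((Jmap_adjoint hS k0).2 _ _ P0_herm Xpsd.1).
rewrite /Pe mx_extend0 mx_extend_left//; last exact: P_C1.1.
by move: DX; rewrite /DZ !innerDl innerNl innerE_state => DX; lra.
Qed.

Lemma inner_extend_ge0 delta (Y : 'M[R[i]]_n) : 0 <= delta <= Tmax ->
  psdmx Y -> 0 <= inner (Pe delta) Y.
Proof.
move=> /andP[d0 dT] Ypsd.
have [Pc _] := mx_extend_primitive 0 Tmax_gt0 P_C1.
have cI : continuous (fun x => inner (Pe x) Y).
  move=> x; apply: cvg_inner => i j; last by split; exact: cvg_cst.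
  by split; [exact: (Pc i j).1|exact: (Pc i j).2].
have pos x : 0 < x < Tmax -> 0 <= inner (Pe x) Y.
  move=> xT; rewrite (_ : Pe x = P x); last exact: mx_extend_in.
  apply: inner_psd_ge0; last exact: Ypsd.
  by apply: P_psd; case/andP: xT => /ltW t0 /ltW tT; rewrite in_itv/= t0.
have [->|d_neq0] := eqVneq delta 0.
  apply: (cvgr_to_ge (cvg_at_right_filter (cI 0))).
  near=> x; apply: pos; apply/andP; split; near: x.
    exact: nbhs_right_gt.
  exact: nbhs_right_lt.
have {d0 d_neq0}d0 : 0 < delta by rewrite lt_neqAle eq_sym d_neq0.
apply: (cvgr_to_ge (cvg_at_left_filter (cI delta))).
near=> x; apply: pos; apply/andP; split.
  by near: x; exact: nbhs_left_gt.
by apply: lt_le_trans dT; near: x; exact: nbhs_left_lt.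
Unshelve. all: by end_near. Qed.

(** One flow interval of cost I1 followed by one jump of cost z, when the value
goes from v to w. *)
Let step_le (I0 I1 s : \bar R) (z v w : R) : (I1 <= (v - (w + z))%:E)%E ->
  (I0 + I1 + (s + z%:E) + w%:E <= I0 + s + v%:E)%E.
Proof.
move=> I1_le; rewrite addeACA -(addeA (I0 + s)%E); apply: leeD2l.
have -> : v%:E = ((v - (w + z))%:E + z%:E + w%:E)%E.
  by rewrite -!EFinD; congr EFin; ring.
by do 2 apply: leeD2r.
Qed.

Section trajectory.
Variable t : nat -> R.
Hypothesis t_dwell : forall k, Tmin <= dwell t k <= Tmax.
Variables (X10 : 'M[R[i]]_n) (X : R -> 'M[R[i]]_(n + m)).
Variable Xm : nat -> 'M[R[i]]_(n + m).
Hypothesis X_traj : is_trajectory S t X10 X Xm.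
Hypothesis X_fb : follows (timer_policy K Kj) t X Xm.

Let t_incr : {homo t : i j / (i < j)%N >-> i < j}.
Proof.
apply: homo_ltn => [j i k|k]; first exact: lt_trans.
by have /andP[/(lt_le_trans Tmin_gt0)] := t_dwell k; rewrite /dwell subr_gt0.
Qed.

Let t_ge0 k : t 0%N <= t k.
Proof. by case: k => // k; exact/ltW/t_incr. Qed.

Let cost_rate s : R := inner (Zflow S (timer t s)) (X s).

Let value k s : R := inner (Pe (s - t k)) (state_block (X s)).

Let cost_rate_ge0 s : t 0%N <= s -> 0 <= cost_rate s.
Proof.
move=> s0; apply: inner_psd_ge0; last exact: (traj_psd X_traj).
apply: (Zflow_psd hS); rewrite subr_ge0; apply: ge_sup.
  by exists (t 0%N); exists 0%N.
by move=> _ [k /= ts <-].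
Qed.

(** The value is a pairing of two absolutely continuous matrix functions, hence
the integral of its almost everywhere derivative, which is minus the running
cost away from the break points of P. *)
Lemma flow_balance k c : t k <= c < t k.+1 ->
  (\int[mu]_(s in `[t k, c]) (cost_rate s)%:E =
   (value k (t k) - value k c)%:E)%E.
Proof.
move=> /andP[kc ck1].
pose rate s := inner (mx_deriv P (s - t k)) (state_block (X s)) +
  inner (Pe (s - t k)) (Fmap S (timer t s) (X s)).
have /andP[_ kT] := t_dwell k; rewrite /dwell lerBlDr in kT.
have pV : primitive (t k) c (value k) rate.
  apply: primitive_inner.
    move=> i j.
    have [_ /(_ i j)[pRe pIm]] := mx_extend_primitive (t k) Tmax_gt0 P_C1.
    have cT := le_trans (ltW ck1) kT.
    by split; [apply: primitive_sub pRe|apply: primitive_sub pIm].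
  have kc' s : s <= c -> t k <= s -> t k <= s < t k.+1.
    by move=> sc ->; rewrite (le_lt_trans sc).
  move=> i j; have [IRe IIm] := traj_integrable X_traj (kc' c (lexx _) kc) i j.
  have E s : s <= c -> t k <= s -> state_block (X s) i j =
      state_block (X (t k)) i j +
      mx_integral `[t k, s] (fun u => Fmap S (timer t u) (X u)) i j.
    by move=> sc ks; rewrite (traj_flow X_traj (kc' s sc ks)) [LHS]mxE.
  split; split=> // s /andP[ks sc].
    by rewrite E// raddfD [mx_integral _ _ _ _]mxE.
  by rewrite E// raddfD [mx_integral _ _ _ _]mxE.
have [B [cB B0 dP]] := piecewise_C1_derivable P_C1.
have rateE s : t k < s <= c -> ~ B (s - t k) -> cost_rate s = - rate s.
  move=> /andP[ks sc] nB.
  have timE : timer t s = s - t k.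
    by apply: timerE => //; rewrite (ltW ks) (le_lt_trans sc).
  have sT : 0 < s - t k < Tmax.
    by rewrite subr_gt0 ks ltrBlDr (le_lt_trans sc)// (lt_le_trans ck1).
  have s0 : t 0%N <= s by rewrite (le_trans (t_ge0 k))// ltW.
  rewrite /rate /cost_rate timE flow_rate ?opprK//.
  - exact: dP.
  - exact: (traj_psd X_traj).
  - by have := X_fb.1 s s0; rewrite /= timE.
have -> : value k (t k) - value k c = - \int[mu]_(s in `[t k, c]) rate s.
  rewrite [value k c]pV.2 ?kc ?lexx// opprD addrA subrr add0r//.
have Irate := pV.1.
have mcost : measurable_fun `[t k, c] cost_rate.
  apply: measurable_funS (traj_cost_measurable X_traj) => //.
  by apply: subset_itv; rewrite bnd_simp.
transitivity (\int[mu]_(s in `[t k, c]) ((-1)%:E * (rate s)%:E))%E.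
  apply: ae_eq_integral => //; first exact/measurable_EFinP.
    apply/measurable_EFinP; apply: measurable_funM => //.
    by case/integrableP: Irate => /measurable_EFinP.
  pose N := (fun b => b + t k) @` B.
  have cN : countable N by apply: card_le_trans cB; exact: card_image_le.
  exists N; split.
  - exact: countable_measurable.
  - exact: countable_lebesgue_measure0.
  - move=> s /= /not_implyP[]; rewrite in_itv/= => /andP[ks sc] neq.
    apply: contrapT => nN; apply: neq.
    have nB : ~ B (s - t k).
      by move=> Bs; apply: nN; exists (s - t k) => //; rewrite subrK.
    rewrite rateE ?mulN1e// lt_neqAle ks sc !andbT.
    by apply/eqP => sk; apply: nB; rewrite sk subrr.
rewrite integralZl// !EFinN mulN1e /Rintegral fineK//.
exact: integrable_fin_num.
Qed.

Let end_value k : R := inner (Pe (dwell t k)) (state_block (Xm k.+1)).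

(** The inputs acting at a jump are not tied to those on the flow before it, but
the value reads the state block only, which has a left limit. *)
Lemma value_left_cvg k : value k s @[s --> (t k.+1)^'-] --> end_value k.
Proof.
have [Pc _] := mx_extend_primitive 0 Tmax_gt0 P_C1.
have shiftc : s - t k @[s --> (t k.+1)^'-] --> dwell t k.
  by apply: cvg_at_left_filter; apply: cvgB; [exact: cvg_id|exact: cvg_cst].
apply: cvg_inner => i j.
  split.
    exact: (cvg_comp (fun s => s - t k) (fun x => complex.Re (Pe x i j))
      shiftc ((Pc i j).1 (dwell t k))).
  exact: (cvg_comp (fun s => s - t k) (fun x => complex.Im (Pe x i j))
    shiftc ((Pc i j).2 (dwell t k))).
have [cRe cIm] := traj_left_cvg X_traj (ltn0Sn k) i j.
by rewrite (traj_left_lim X_traj (ltn0Sn k)) mxE; split.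
Qed.

(** The running cost is nonnegative, so the value decreases to its limit. *)
Lemma end_value_le k c : t k <= c < t k.+1 -> end_value k <= value k c.
Proof.
move=> /andP[kc ck1]; apply: (cvgr_to_le (value_left_cvg (k := k))).
near=> d.
have cd : c <= d by near: d; exact: nbhs_left_ge.
have dk1 : d < t k.+1 by near: d; exact: nbhs_left_lt.
have Ec := flow_balance (c := c) (k := k).
have Ed := flow_balance (c := d) (k := k).
rewrite kc ck1 in Ec; rewrite (le_trans kc cd) dk1 in Ed.
have : (\int[mu]_(s in `[t k, c]) (cost_rate s)%:E <=
        \int[mu]_(s in `[t k, d]) (cost_rate s)%:E)%E.
  apply: ge0_subset_integral => //.
  - apply/measurable_EFinP.
    apply: measurable_funS (traj_cost_measurable X_traj) => //.
    by apply: subset_itv; rewrite bnd_simp.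
  - move=> s /=; rewrite in_itv/= => /andP[ks _]; rewrite lee_fin.
    exact: cost_rate_ge0 (le_trans (t_ge0 k) ks).
  - by apply: subset_itv; rewrite bnd_simp.
by rewrite (Ec isT) (Ed isT) lee_fin lerD2l lerN2.
Unshelve. all: by end_near. Qed.

Lemma interval_dissipation k :
  (\int[mu]_(s in `[t k, t k.+1[) (cost_rate s)%:E <=
   (value k (t k) - end_value k)%:E)%E.
Proof.
have m_rate : measurable_fun `[t k, t k.+1[ cost_rate.
  apply: measurable_funS (traj_cost_measurable X_traj) => //.
  by apply: subset_itv; rewrite bnd_simp.
apply: integral_bnd_open_le => //; first exact: t_incr.
  by move=> s /andP[ks _]; rewrite cost_rate_ge0// (le_trans (t_ge0 k)).
move=> c kc; rewrite (flow_balance kc) lee_fin lerD2l lerN2.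
exact: end_value_le.
Qed.

Lemma cumulated_dissipation N :
  (\int[mu]_(s in `[t 0%N, t N[) (cost_rate s)%:E +
   \sum_(1 <= k < N.+1) (inner (Zjump S k) (Xm k))%:E +
   (inner (Pe 0) (state_block (X (t N))))%:E <= (inner (Pe 0) X10)%:E)%E.
Proof.
elim: N => [|N IH].
  by rewrite set_itvco0 integral_set0 big_nil !add0e -(traj_init X_traj).
apply: le_trans IH.
have tN : t N < t N.+1 by exact: t_incr.
have mZ : measurable_fun `[t 0%N, t N.+1[ cost_rate.
  apply: measurable_funS (traj_cost_measurable X_traj) => //.
  by apply: subset_itv; rewrite bnd_simp.
have pos s : t 0%N <= s < t N.+1 -> 0 <= cost_rate s.
  by move=> /andP[s0 _]; exact: cost_rate_ge0.
rewrite (ge0_integral_itv_cat (t_ge0 N) (ltW tN) mZ pos).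
have XN : psdmx (Xm N.+1) by exact: (traj_jump_psd X_traj).
have jumpE := jump_balance (ltn0Sn N) (t_dwell N) XN (X_fb.2 _ (ltn0Sn N)).
rewrite -(traj_jump X_traj (ltn0Sn N)) in jumpE.
have flowN := interval_dissipation N.
have valueN : value N (t N) = inner (Pe 0) (state_block (X (t N))).
  exact: (congr1 (fun u => inner (Pe u) (state_block (X (t N)))) (subrr (t N))).
rewrite valueN /end_value -jumpE in flowN.
rewrite (big_nat_recr N.+1 1 _ isT).
exact: step_le flowN.
Qed.

Let jump_cost_ge0 k : (0 < k)%N -> 0 <= inner (Zjump S k) (Xm k).
Proof.
move=> k0; apply: inner_psd_ge0; first exact: (Zjump_psd hS).
exact: (traj_jump_psd X_traj).
Qed.

Let t_unbounded x : exists k, x < t k.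
Proof.
have tk k : t 0%N + k%:R * Tmin <= t k.
  elim: k => [|k IH]; first by rewrite mul0r addr0.
  rewrite -natr1 mulrDl mul1r addrA.
  have /andP[+ _] := t_dwell k; rewrite /dwell lerBrDl; apply: le_trans.
  by rewrite lerD2r.
have [k xk] : exists k, (x - t 0%N) / Tmin < k%:R.
  exists (Num.bound `|(x - t 0%N) / Tmin|).
  exact: le_lt_trans (ler_norm _) (archi_boundP (normr_ge0 _)).
exists k; apply: lt_le_trans (tk k).
by rewrite -ltrBlDl -ltr_pdivrMr.
Qed.

Let infinite_horizon :
  [set s | (t 0%N <= s)%R /\ (s%:E <= (t 0%N)%:E + +oo)%E] =
  `[t 0%N, +oo[%classic.
Proof.
by apply/seteqP; split=> s /=; rewrite in_itv/= andbT addey// leey => -[].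
Qed.

(** The value left over at t_N is nonnegative, so the cost up to t_N is bounded
uniformly in N. *)
Lemma total_cost_le :
  (cost S t X Xm +oo <= (inner (mx_lim 0^'+ P) X10)%:E)%E.
Proof.
rewrite -(mx_extend0 Tmax) /cost.
rewrite infinite_horizon.
under [X in (_ + X <= _)%E]eq_eseriesl do rewrite addey// ltry.
apply: integral_series_le => //.
- by move=> i j; rewrite leq_eqVlt => /predU1P[->//|/t_incr/ltW].
- exact: traj_cost_measurable X_traj.
- move=> N; apply: le_trans (cumulated_dissipation N); apply: leeDl.
  rewrite lee_fin; apply: inner_extend_ge0; first by rewrite lexx ltW.
  exact/psd_state_block/(traj_psd X_traj).
Qed.

Lemma cost_le_total T : (cost S t X Xm T%:E <= cost S t X Xm +oo)%E.
Proof.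
rewrite /cost; apply: leeD.
  rewrite infinite_horizon.
  have -> : [set s | (t 0%N <= s)%R /\ (s%:E <= (t 0%N)%:E + T%:E)%E] =
      `[t 0%N, t 0%N + T]%classic.
    by apply/seteqP; split=> s /=; rewrite in_itv/= -EFinD lee_fin => /andP.
  apply: ge0_subset_integral => //.
  - by apply/measurable_EFinP; exact: traj_cost_measurable X_traj.
  - by move=> s /=; rewrite in_itv/= andbT lee_fin; exact: cost_rate_ge0.
  - exact: subset_itvl.
(* Compared through partial sums: the jump cost of index 0 has no sign. *)
apply: lee_lim.
- by apply: is_cvg_nneseries => k k1 _; rewrite lee_fin jump_cost_ge0.
- by apply: is_cvg_nneseries => k k1 _; rewrite lee_fin jump_cost_ge0.
near=> N; rewrite [leLHS]big_mkcond [leRHS]big_mkcond/=.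
rewrite big_nat_cond [leRHS]big_nat_cond.
apply: lee_sum => k; rewrite andbT => /andP[k1 _]; rewrite addey// ltry.
by case: ifP => // _; rewrite lee_fin jump_cost_ge0.
Unshelve. all: by end_near. Qed.
End trajectory.
End closed_loop.

(** * The policy *)

Lemma gain_selection_exists (R : realType) (n m : nat) (S : hsystem R n m)
    (Tmin Tmax : R) (P : R -> 'M[R[i]]_n) :
  (forall tau : R, tau \in `]0, Tmax[ -> mx_derivable P tau ->
     psdmx (CZ S P tau)) ->
  (forall (k : nat) (tau : R), (0 < k)%N -> tau \in `[Tmin, Tmax] ->
     psdmx (DZ S k (mx_lim 0^'+ P) (mx_lim tau^'- P))) ->
  exists K Kj, gain_selection S Tmin Tmax P K Kj.
Proof.
move=> C_psd D_psd.
have /choice[K hK] tau : exists k, tau \in `]0, Tmax[ -> mx_derivable P tau ->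
    Kc S P tau k.
  have [[tauT dP]|H] := pselect ((tau \in `]0, Tmax[) /\ mx_derivable P tau).
    by have [k ?] := gain_set_nonempty (C_psd _ tauT dP); exists k.
  by exists 0 => tauT dP; case: H.
have /choice[Kj hKj] (kd : nat * R) : exists k, (0 < kd.1)%N ->
    kd.2 \in `[Tmin, Tmax] ->
    Kd S kd.1 (mx_lim 0^'+ P) (mx_lim kd.2^'- P) k.
  have [[k0 dT]|H] := pselect ((0 < kd.1)%N /\ kd.2 \in `[Tmin, Tmax]).
    by have [k ?] := gain_set_nonempty (D_psd _ _ k0 dT); exists k.
  by exists 0 => k0 dT; case: H.
by exists K, (fun k d => Kj (k, d)); split=> [//|k d]; exact: (hKj (k, d)).
Qed.

Lemma timer_policy_causal (R : realType) (n m : nat)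
    (K : R -> 'M[R[i]]_(m, n)) (Kj : nat -> R -> 'M[R[i]]_(m, n)) :
  causal (timer_policy K Kj).
Proof.
move=> t t' _ _ k same_past; split=> [s s' _ _ /= -> //|k0 /=].
by rewrite same_past// prednK.
Qed.

Theorem theorem3p22 (R : realType) (n m : nat) (S : hsystem R n m)
  (Tmin Tmax : R) (Ps : R -> 'M[R[i]]_n)
  (hn : (1 <= n)%N) (hm : (1 <= m)%N)
  (hS : standing_assumptions S)
  (hTmin : 0 < Tmin) (hTmax : Tmin <= Tmax)
  (hPC1 : piecewise_C1 Tmax Ps)
  (hPpsd : forall tau : R, tau \in `[0, Tmax] -> psdmx (Ps tau))
  (hi : forall tau : R, tau \in `]0, Tmax[ -> mx_derivable Ps tau ->
     psdmx (CZ S Ps tau) /\ schur (CZ S Ps tau) = 0)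
  (hii : forall (k : nat) (tau : R), (1 <= k)%N -> tau \in `[Tmin, Tmax] ->
     psdmx (DZ S k (mx_lim 0^'+ Ps) (mx_lim tau^'- Ps)) /\
     schur (DZ S k (mx_lim 0^'+ Ps) (mx_lim tau^'- Ps)) = 0) :
  (exists K Kj, gain_selection S Tmin Tmax Ps K Kj) /\
  forall (K : R -> 'M[R[i]]_(m, n)) (Kj : nat -> R -> 'M[R[i]]_(m, n)),
    gain_selection S Tmin Tmax Ps K Kj ->
    [/\ causal (timer_policy K Kj),
        (forall (t t' : nat -> R) (k : nat), (1 <= k)%N ->
           dwell t k.-1 = dwell t' k.-1 ->
           jump_gain (timer_policy K Kj) t k =
           jump_gain (timer_policy K Kj) t' k) &
        forall t : nat -> R,
          (forall k, Tmin <= dwell t k <= Tmax) ->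
        forall X10 : 'M[R[i]]_n, psdmx X10 ->
        forall (Xstar : R -> 'M[R[i]]_(n + m)) (Xmstar : nat -> 'M[R[i]]_(n + m)),
          is_trajectory S t X10 Xstar Xmstar ->
          follows (timer_policy K Kj) t Xstar Xmstar ->
          (forall T : R, 0 < T ->
             (cost S t Xstar Xmstar T%:E <= (inner (mx_lim 0^'+ Ps) X10)%:E)%E)
          /\ (optimal_cost S t X10 <= (inner (mx_lim 0^'+ Ps) X10)%:E)%E].
Proof.
split.
  apply: gain_selection_exists => [tau tauT dP|k tau k1 tauT].
    by have [] := hi _ tauT dP.
  by have [] := hii _ _ k1 tauT.
move=> K Kj KP; split; first exact: timer_policy_causal.
  by move=> t t' k _ /= ->.
move=> t t_dwell X10 _ X Xm X_traj X_fb.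
have total :=
  total_cost_le hS hTmin hTmax hPC1 hPpsd hi hii KP t_dwell X_traj X_fb.
split.
  move=> T _; apply: le_trans total.
  exact: (cost_le_total hS X_traj).
by apply: le_trans total; apply: ereal_inf_lbound; exists X, Xm.
Qed.
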